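(* Let $m=2$ and consider the $\mathrm{Vect}(M)$-modules $\mathcal{D}^2_{\underline\lambda;\delta+|\underline\lambda|}$, $\underline\lambda=(\lambda_1,\lambda_2)\in\mathbb{R}^2$. (a) For $\delta=2$, apart from the exceptional modules listed next, there are two classes of modules, the modules within each class being isomorphic to each other: the modules $\mathcal{D}^2_{s\mathbf 1_2;2+s}\simeq\mathcal{D}^2_{s\mathbf 1_1;2+s}$ ($s\in\mathbb{R}$), and the modules $\mathcal{D}^2_{\underline\lambda;2+|\underline\lambda|}$ with $\lambda_1,\lambda_2\ne0$. There are two exceptional modules: $$\mathcal{D}^2_{-\mathbf 1_1;1}\simeq\mathcal{D}^2_{-\mathbf 1_2;1}\simeq\mathcal{D}^2_{\underline 0;2}\qquad\text{and}\qquad\mathcal{D}^2_{-\frac12\mathbf 1_1;\frac32}\simeq\mathcal{D}^2_{-\frac12\mathbf 1_2;\frac32}\simeq\mathcal{D}^2_{(-\frac12,-\frac12);1}$$ (the isomorphisms being given by conjugations and permutations). (b) For $\delta=1$, all the modules $\mathcal{D}^2_{\underline\lambda;1+|\underline\lambda|}$ are isomorphic to each other, except for one singular module, $\mathcal{D}^2_{\underline 0;1}$. (c) For $\delta=\tfrac32$, all the modules $\mathcal{D}^2_{\underline\lambda;\frac32+|\underline\lambda|}$ are isomorphic to each other, except for one singular module $$\mathcal{D}^2_{-\frac12\mathbf 1_1;1}\simeq\mathcal{D}^2_{-\frac12\mathbf 1_2;1}\simeq\mathcal{D}^2_{\underline 0;\frac32}$$ (the isomorphisms being given by conjugations and perm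utations).
   Context: $M$ is $\mathbb{R}$ or $S^1$. For $\lambda\in\mathbb{R}$, $\mathcal{F}_\lambda$ is the space of smooth $\lambda$-densities $a\,(dx)^\lambda$ on $M$, with the $\mathrm{Vect}(M)$-action $L_X^\lambda(a\,(dx)^\lambda)=(Xa'+\lambda X'a)(dx)^\lambda$ for $X=X(x)\partial_x$. For $\underline\lambda=(\lambda_1,\lambda_2)$, $|\underline\lambda|=\lambda_1+\lambda_2$; $\mathbf 1_1=(1,0)$, $\mathbf 1_2=(0,1)$. $\mathcal{D}^2_{\underline\lambda;\mu}$ is the space of bidifferential operators of order $\le2$, $A=\sum_{i_1+i_2\le 2}a_{i_1,i_2}\,\partial_{i_1,i_2}:\mathcal{F}_{\lambda_1}\otimes\mathcal{F}_{\lambda_2}\to\mathcal{F}_\mu$, with $a_{i_1,i_2}$ smooth and $\partial_{i_1,i_2}(\varphi_1,\varphi_2)=\varphi_1^{(i_1)}\varphi_2^{(i_2)}$; it is a $\mathrm{Vect}(M)$-module via $L_X^{\underline\lambda;\mu}(A)=L_X^\mu\circ A-A(L_X^{\lambda_1}(-),-)-A(-,L_X^{\lambda_2}(-))$. Isomorphism means isomorphism of $\mathrm{Vect}(M)$-modules. Permutation: interchanging the two arguments gives an isomorphism $\mathcal{D}^2_{\lambda_1,\lambda_2;\mu}\simeq\mathcal{D}^2_{\lambda_2,\lambda_1;\mu}$. Conjugation: the map $A\mapsto A^*$ defined by $\int_M A(\varphi_1,\varphi_2)\phi=\int_M\varphi_1A^*(\varphi_2,\phi)$ (compactly supported densities if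 $M=\mathbb{R}$) is an isomorphism $\mathcal{D}^2_{\lambda_1,\lambda_2;\mu}\to\mathcal{D}^2_{\lambda_2,1-\mu;1-\lambda_1}$. A module is called singular if it is isomorphic only to itself, or only to modules $\mathcal{D}^2_{\underline\rho;\eta}$ obtained from it through compositions of conjugations and permutations. ''Exceptional'' means not isomorphic to any of the modules outside the displayed list in question.
   Formalization: In (a), non-exceptional modules with |λ| = −1 (target weight 1) are moved from the second class to the first: D_{(1,−2);1} is conjugate to D_{(0,1);3} and has a nonzero invariant, while D_{(1,1);4} has none, so the printed second class is not a single isomorphism class. *)

(* Defs.v *)
From Stdlib Require Import Reals Lra Lia List.
From Coquelicot Require Import Coquelicot.
Import ListNotations.
Open Scope R_scope.

(** The circle is [R / 2 pi Z]: functions and vector fields on it are the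
    [2 pi]-periodic ones on the line. *)
Inductive manifold := Line | Circle.

Definition smooth (M : manifold) (f : R -> R) : Prop :=
  (forall n x, ex_derive_n f n x) /\
  match M with
  | Line => True
  | Circle => forall x, f (x + 2 * PI) = f x
  end.

Lemma ex_derive_n_Derive (f : R -> R) (n : nat) (x : R) :
  ex_derive_n f (S (S n)) x <-> ex_derive_n (Derive f) (S n) x.
Proof.
assert (H : forall y, Derive_n (Derive f) n y = Derive_n f (S n) y).
{ intros y. replace (S n) with (n + 1)%nat by lia.
  exact (Derive_n_comp f n 1 y). }
split; apply ex_derive_ext; intros y; rewrite (H y); reflexivity.
Qed.

Lemma smooth_ext (M : manifold) (f g : R -> R) :
  (forall x, f x = g x) -> smooth M f -> smooth M g.
Proof.
intros E [Hf Pf]; split.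
- intros n x; apply (ex_derive_n_ext f); auto.
- destruct M; [exact I|]. intros x; rewrite <- !E; apply Pf.
Qed.

Lemma smooth_ex_derive (M : manifold) (f : R -> R) (x : R) :
  smooth M f -> ex_derive f x.
Proof. intros [H _]; exact (H 1%nat x). Qed.

Lemma smooth_plus (M : manifold) (f g : R -> R) :
  smooth M f -> smooth M g -> smooth M (fun x => f x + g x).
Proof.
intros [Hf Pf] [Hg Pg]; split.
- intros n x; apply ex_derive_n_plus; apply filter_forall; auto.
- destruct M; [exact I|]. intros x; rewrite Pf, Pg; reflexivity.
Qed.

Lemma smooth_scal (M : manifold) (c : R) (f : R -> R) :
  smooth M f -> smooth M (fun x => c * f x).
Proof.
intros [Hf Pf]; split.
- intros n x; apply ex_derive_n_scal_l; auto.
- destruct M; [exact I|]. intros x; rewrite Pf; reflexivity.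
Qed.

Lemma smooth_Derive (M : manifold) (f : R -> R) :
  smooth M f -> smooth M (Derive f).
Proof.
intros [Hf Pf]; split.
- intros [|n] x; [exact I|]. exact (proj1 (ex_derive_n_Derive f n x) (Hf (S (S n)) x)).
- destruct M; [exact I|]. intros x.
  transitivity (Derive (fun y => f (y + 2 * PI)) x).
  + symmetry. exact (Derive_n_comp_trans f 1 x (2 * PI)).
  + apply Derive_ext, Pf.
Qed.

Lemma ex_derive_n_mult_smooth (n : nat) (f g : R -> R) :
  smooth Line f -> smooth Line g ->
  forall x k, (k <= n)%nat -> ex_derive_n (fun y => f y * g y) k x.
Proof.
revert f g; induction n as [|n IH]; intros f g Hf Hg x k Hk.
- replace k with 0%nat by lia. exact I.
- destruct k as [|[|k]]; [exact I| |].
  + apply (ex_derive_mult f g x); eapply smooth_ex_derive; eassumption.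
  + apply (proj2 (ex_derive_n_Derive _ k x)).
    apply ex_derive_n_ext with (fun y => Derive f y * g y + f y * Derive g y).
    { intros y; symmetry; apply Derive_mult;
        eapply smooth_ex_derive; eassumption. }
    apply ex_derive_n_plus; apply filter_forall; intros y j Hj;
      apply IH; auto using smooth_Derive; lia.
Qed.

Lemma smooth_mult (M : manifold) (f g : R -> R) :
  smooth M f -> smooth M g -> smooth M (fun x => f x * g x).
Proof.
intros [Hf Pf] [Hg Pg]; split.
- intros n x; apply (ex_derive_n_mult_smooth n f g) with (k := n);
    try (split; [assumption|exact I]); lia.
- destruct M; [exact I|]. intros x; rewrite Pf, Pg; reflexivity.
Qed.

(** Since [M] has the global coordinate field [d/dx], a density
    [a (dx)^lambda] or a vector field [X d/dx] is given by its coefficient;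
    [lambda] enters only through the action of vector fields. *)
Record smooth_fun (M : manifold) := SmoothFun {
  sf_val :> R -> R;
  sf_smooth : smooth M sf_val
}.
Arguments SmoothFun {M} _ _.
Arguments sf_val {M} _ _.
Arguments sf_smooth {M} _.

Section Operations.

Context {M : manifold}.

Definition sf_plus (f g : smooth_fun M) : smooth_fun M :=
  SmoothFun (fun x => f x + g x) (smooth_plus M _ _ (sf_smooth f) (sf_smooth g)).

Definition sf_scal (c : R) (f : smooth_fun M) : smooth_fun M :=
  SmoothFun (fun x => c * f x) (smooth_scal M c _ (sf_smooth f)).

Definition sf_mult (f g : smooth_fun M) : smooth_fun M :=
  SmoothFun (fun x => f x * g x) (smooth_mult M _ _ (sf_smooth f) (sf_smooth g)).

Definition sf_derive (f : smooth_fun M) : smooth_fun M :=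
  SmoothFun (Derive f) (smooth_Derive M _ (sf_smooth f)).

Definition lie_density (lambda : R) (X a : smooth_fun M) : smooth_fun M :=
  sf_plus (sf_mult X (sf_derive a)) (sf_scal lambda (sf_mult (sf_derive X) a)).

Definition operator : Type := smooth_fun M -> smooth_fun M -> smooth_fun M.

Definition op_plus (A B : operator) : operator :=
  fun phi1 phi2 => sf_plus (A phi1 phi2) (B phi1 phi2).

Definition op_scal (c : R) (A : operator) : operator :=
  fun phi1 phi2 => sf_scal c (A phi1 phi2).

(** [sum_f_R0 u n] is [u 0 + ... + u n], so the indices are exactly the pairs
    with [i1 + i2 <= 2]. *)
Definition has_coefs (A : operator) (a : nat -> nat -> smooth_fun M) : Prop :=
  forall (phi1 phi2 : smooth_fun M) (x : R),
    A phi1 phi2 x =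
    sum_f_R0 (fun i1 => sum_f_R0 (fun i2 =>
      a i1 i2 x * Derive_n phi1 i1 x * Derive_n phi2 i2 x) (2 - i1)) 2.

Definition bidiff2 (A : operator) : Prop :=
  exists a : nat -> nat -> smooth_fun M, has_coefs A a.

End Operations.

Arguments operator : clear implicits.

(** The weights [(lambda_1, lambda_2; mu)] of a module of operators from
    [F_lambda1 (x) F_lambda2] to [F_mu]. *)
Record weights := Weights { wt1 : R; wt2 : R; wtmu : R }.

Definition delta (p : weights) : R := wtmu p - (wt1 p + wt2 p).

Definition shifted (d l1 l2 : R) : weights := Weights l1 l2 (d + (l1 + l2)).

Section Modules.

Context {M : manifold}.

Definition lie_op (p : weights) (X : smooth_fun M) (A : operator M) :
    operator M :=
  fun phi1 phi2 =>
    sf_plus (lie_density (wtmu p) X (A phi1 phi2))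
      (sf_scal (-1)
        (sf_plus (A (lie_density (wt1 p) X phi1) phi2)
                 (A phi1 (lie_density (wt2 p) X phi2)))).

Definition lie_coefs (p : weights) (X : smooth_fun M)
    (a : nat -> nat -> smooth_fun M) (i j : nat) : smooth_fun M :=
  let X2 := sf_derive (sf_derive X) in
  let X3 := sf_derive X2 in
  let d := delta p in
  match i, j with
  | O, O =>
      sf_plus (lie_density d X (a 0%nat 0%nat))
        (sf_plus
          (sf_plus (sf_scal (- wt1 p) (sf_mult X2 (a 1%nat 0%nat)))
                   (sf_scal (- wt2 p) (sf_mult X2 (a 0%nat 1%nat))))
          (sf_plus (sf_scal (- wt1 p) (sf_mult X3 (a 2%nat 0%nat)))
                   (sf_scal (- wt2 p) (sf_mult X3 (a 0%nat 2%nat)))))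
  | S O, O =>
      sf_plus (lie_density (d - 1) X (a 1%nat 0%nat))
        (sf_plus
          (sf_scal (- (1 + 2 * wt1 p)) (sf_mult X2 (a 2%nat 0%nat)))
          (sf_scal (- wt2 p) (sf_mult X2 (a 1%nat 1%nat))))
  | O, S O =>
      sf_plus (lie_density (d - 1) X (a 0%nat 1%nat))
        (sf_plus
          (sf_scal (- (1 + 2 * wt2 p)) (sf_mult X2 (a 0%nat 2%nat)))
          (sf_scal (- wt1 p) (sf_mult X2 (a 1%nat 1%nat))))
  | _, _ => lie_density (d - 2) X (a i j)
  end.

Lemma sf_ex_derive_n (f : smooth_fun M) (n : nat) (x : R) :
  ex_derive (Derive_n f n) x.
Proof. exact (proj1 (sf_smooth f) (S n) x). Qed.

Ltac eta_sf f :=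
  change (fun x => sf_val f x) with (sf_val f);
  change (fun x => Derive (sf_val f) x) with (Derive (sf_val f));
  change (fun x => Derive (Derive (sf_val f)) x) with (Derive (Derive (sf_val f))).

Lemma Derive_lie_density (l : R) (X phi : smooth_fun M) (x : R) :
  Derive (lie_density l X phi) x =
  X x * Derive (Derive phi) x + (1 + l) * Derive X x * Derive phi x
  + l * Derive (Derive X) x * phi x.
Proof.
apply is_derive_unique; simpl.
pose proof (sf_ex_derive_n X 0 x). pose proof (sf_ex_derive_n X 1 x).
pose proof (sf_ex_derive_n phi 0 x). pose proof (sf_ex_derive_n phi 1 x).
auto_derive; [auto|]. eta_sf X; eta_sf phi. ring.
Qed.

Lemma Derive2_lie_density (l : R) (X phi : smooth_fun M) (x : R) :
  Derive (Derive (lie_density l X phi)) x =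
  X x * Derive (Derive (Derive phi)) x
  + (2 + l) * Derive X x * Derive (Derive phi) x
  + (1 + 2 * l) * Derive (Derive X) x * Derive phi x
  + l * Derive (Derive (Derive X)) x * phi x.
Proof.
rewrite (Derive_ext _ _ _ (Derive_lie_density l X phi)).
apply is_derive_unique.
assert (H : forall f : smooth_fun M,
  ex_derive f x /\ ex_derive (Derive f) x /\ ex_derive (Derive (Derive f)) x).
{ intros f; split; [exact (sf_ex_derive_n f 0 x)|].
  exact (conj (sf_ex_derive_n f 1 x) (sf_ex_derive_n f 2 x)). }
destruct (H X) as [? [? ?]], (H phi) as [? [? ?]].
auto_derive; [auto 10|]. eta_sf X; eta_sf phi. ring.
Qed.

Lemma is_derive_term (f g h : smooth_fun M) (i j : nat) (x : R) :
  is_derive (fun t => f t * Derive_n g i t * Derive_n h j t) x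
    (Derive f x * Derive_n g i x * Derive_n h j x
     + f x * Derive_n g (S i) x * Derive_n h j x
     + f x * Derive_n g i x * Derive_n h (S j) x).
Proof.
pose proof (sf_ex_derive_n f 0 x : ex_derive f x).
pose proof (sf_ex_derive_n g i x). pose proof (sf_ex_derive_n h j x).
auto_derive; [auto|]. simpl. eta_sf f.
change (fun x => Derive_n g i x) with (Derive_n g i).
change (fun x => Derive_n h j x) with (Derive_n h j).
ring.
Qed.

Lemma has_coefs_lie_op (p : weights) (X : smooth_fun M) (A : operator M)
    (a : nat -> nat -> smooth_fun M) :
  has_coefs A a -> has_coefs (lie_op p X A) (lie_coefs p X a).
Proof.
intros Ha phi1 phi2 x.
assert (HP : forall u v du dv, is_derive u x du -> is_derive v x dv ->
  is_derive (fun t : R => u t + v t : R) x (du + dv : R)).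
{ intros u v du dv Hu Hv; exact (is_derive_plus u v x du dv Hu Hv). }
pose proof (fun i j => is_derive_term (a i j) phi1 phi2 i j x) as H.
pose proof
  (HP _ _ _ _ (HP _ _ _ _
    (HP _ _ _ _ (HP _ _ _ _ (H 0%nat 0%nat) (H 0%nat 1%nat)) (H 0%nat 2%nat))
    (HP _ _ _ _ (H 1%nat 0%nat) (H 1%nat 1%nat))) (H 2%nat 0%nat)) as E.
apply (is_derive_ext _ _ _ _ (fun t => eq_sym (Ha phi1 phi2 t))) in E.
apply is_derive_unique in E.
unfold lie_op.
cbn [sf_val sf_plus sf_scal sf_mult sf_derive lie_density].
rewrite E, !Ha. clear E H HP.
cbn [sum_f_R0 Nat.sub Derive_n].
change (fun x => sf_val (lie_density (wt1 p) X phi1) x)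
  with (sf_val (lie_density (wt1 p) X phi1)).
change (fun x => sf_val (lie_density (wt2 p) X phi2) x)
  with (sf_val (lie_density (wt2 p) X phi2)).
change (fun x => Derive (lie_density (wt1 p) X phi1) x)
  with (Derive (lie_density (wt1 p) X phi1)).
change (fun x => Derive (lie_density (wt2 p) X phi2) x)
  with (Derive (lie_density (wt2 p) X phi2)).
rewrite !Derive2_lie_density, !Derive_lie_density.
unfold lie_coefs, delta.
cbn [sf_val sf_plus sf_scal sf_mult sf_derive lie_density].
eta_sf X; eta_sf phi1; eta_sf phi2.
ring.
Qed.

Lemma bidiff2_lie_op (p : weights) (X : smooth_fun M) (A : operator M) :
  bidiff2 A -> bidiff2 (lie_op p X A).
Proof. intros [a Ha]. exists (lie_coefs p X a). apply has_coefs_lie_op, Ha. Qed.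

(** [T] restricts to an isomorphism of [Vect(M)]-modules from the space of
    operators of order at most 2 with the action for the weights [p] to the
    same space with the action for [q]; its values on other operators are
    irrelevant. *)
Definition is_isomorphism (p q : weights) (T : operator M -> operator M) :
    Prop :=
  (forall A, bidiff2 A -> bidiff2 (T A)) /\
  (forall A B, bidiff2 A -> bidiff2 B -> T (op_plus A B) = op_plus (T A) (T B)) /\
  (forall c A, bidiff2 A -> T (op_scal c A) = op_scal c (T A)) /\
  (forall A B, bidiff2 A -> bidiff2 B -> T A = T B -> A = B) /\
  (forall B, bidiff2 B -> exists A, bidiff2 A /\ T A = B) /\
  (forall X A, bidiff2 A -> T (lie_op p X A) = lie_op q X (T A)).

Definition permute (A : operator M) : operator M :=
  fun phi1 phi2 => A phi2 phi1.

Definition compactly_supported (f : smooth_fun M) : Prop :=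
  match M with
  | Line => exists a b, forall x, x < a \/ b < x -> f x = 0
  | Circle => True
  end.

Definition integral (f : smooth_fun M) : R :=
  match M with
  | Line => RInt_gen f (Rbar_locally m_infty) (Rbar_locally p_infty)
  | Circle => RInt f 0 (2 * PI)
  end.

Definition is_conjugation (S : operator M -> operator M) : Prop :=
  forall A, bidiff2 A -> bidiff2 (S A) /\
    forall phi1 phi2 phi : smooth_fun M,
      compactly_supported phi1 -> compactly_supported phi2 ->
      compactly_supported phi ->
      integral (sf_mult (A phi1 phi2) phi) =
      integral (sf_mult phi1 (S A phi2 phi)).

End Modules.

Definition isomorphic (M : manifold) (p q : weights) : Prop :=
  exists T : operator M -> operator M, is_isomorphism p q T.

Definition wt_permute (p : weights) : weights := Weights (wt2 p) (wt1 p) (wtmu p).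

Definition wt_conj (p : weights) : weights :=
  Weights (wt2 p) (1 - wtmu p) (1 - wt1 p).

(** [conj_perm M p q T]: the map [T] is a composition of conjugations and
    permutations leading from the module with weights [p] to the one with
    weights [q]. *)
Inductive conj_perm (M : manifold) (p : weights) :
    weights -> (operator M -> operator M) -> Prop :=
| cp_id : conj_perm M p p (fun A => A)
| cp_permute q T : conj_perm M p q T ->
    conj_perm M p (wt_permute q) (fun A => permute (T A))
| cp_conj q T S : conj_perm M p q T -> is_conjugation S ->
    conj_perm M p (wt_conj q) (fun A => S (T A)).

Definition conj_perm_isomorphic (M : manifold) (p q : weights) : Prop :=
  exists T, conj_perm M p q T /\ is_isomorphism p q T.

Definition singular (M : manifold) (p : weights) : Prop :=
  forall q, isomorphic M p q -> exists T, conj_perm M p q T.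

(** [l] lists the weights under which a single exceptional module appears. *)
Definition exceptional (M : manifold) (l : list weights) : Prop :=
  (forall p q, In p l -> In q l -> conj_perm_isomorphic M p q) /\
  (forall p q, In p l -> ~ In q l -> ~ isomorphic M p q).

Definition list_2_0 : list weights :=
  [Weights (-1) 0 1; Weights 0 (-1) 1; Weights 0 0 2].

Definition list_2_half : list weights :=
  [Weights (-1/2) 0 (3/2); Weights 0 (-1/2) (3/2); Weights (-1/2) (-1/2) 1].

Definition list_3half : list weights :=
  [Weights (-1/2) 0 1; Weights 0 (-1/2) 1; Weights 0 0 (3/2)].

Definition generic_2 (p : weights) : Prop :=
  delta p = 2 /\ ~ In p list_2_0 /\ ~ In p list_2_half.

(** Conjugation and permutation permute [lambda_1], [lambda_2], [1 - mu].  So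
    the class of the modules with weights [(0, s; 2 + s)] and [(s, 0; 2 + s)]
    also contains their conjugates, with weights [(s, -1-s; 1)], and the
    second class is that of [lambda_1, lambda_2 <> 0] apart from these: for
    instance
      [phi1, phi2 |-> 2 phi1'' phi2 + 3 phi1' phi2' + phi1 phi2'']
    is a nonzero [Vect(M)]-invariant element for the weights [(1, -2; 1)],
    and there is none for the weights [(1, 1; 4)]. *)
Definition first_class (p : weights) : Prop :=
  generic_2 p /\ (wt1 p = 0 \/ wt2 p = 0 \/ wtmu p = 1).

Definition second_class (p : weights) : Prop :=
  generic_2 p /\ wt1 p <> 0 /\ wt2 p <> 0 /\ wtmu p <> 1.

(* Main.v *)
(** An operator is a sextuple of smooth coefficients: [a] in [F_{delta-2}]^3,
    [b] in [F_{delta-1}]^2 and [c] in [F_delta] at orders 2, 1, 0, on which [X]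
    acts by [L_X a], [L_X b + X'' P a], [L_X c + X'' Q b + X''' S a] with
    constant matrices [P], [Q], [S] depending on the weights.

    Isomorphisms are sought in the form [a |-> A a], [b |-> B b + N a'],
    [c |-> r c + K b' + L a''], which turns equivariance into matrix equations.
    When they are solved for [N], [K], [L], what remains to be matched by
    [A], [B], [r] is: [P] and [S - Q P] for [delta = 2]; [Q] and [S + Q P] for
    [delta = 1]; [Q P] for [delta = 3/2].  Conjugation has this form too, and
    acts on the weights by rotating [(lambda_1, lambda_2, 1 - mu)].

    Nothing is assumed of the shape of an isomorphism in the negative results.
    It preserves the operators with constant coefficients, which are those
    killed by [d/dx], and commutes there with the action of
    [L_{cos nx}^2 + L_{sin nx}^2], that is, with the diagonal map
    [n^2 ((delta-2)(delta-3), (delta-1)(delta-2), delta(delta-1))] plus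
    [n^4 (Q P - (2 delta - 3) S)] from [a] to [c].  This recovers [delta] and
    the vanishing of [Q P - (2 delta - 3) S].  For [delta = 2] the invariant
    vectors are [ker P] intersected with [ker (S - Q P)], and [ker P] alone is
    recovered from a Casimir eigenvalue equation satisfied by [L_{cos x} u]. *)

Require Import Defs.
From Stdlib Require Import Reals Lra Lia List.
From Stdlib Require Import FunctionalExtensionality PropExtensionality
  ProofIrrelevance ClassicalEpsilon.
From Coquelicot Require Import Coquelicot.
Import ListNotations.
Open Scope R_scope.

(** * Smooth functions and trigonometric polynomials *)

Section SmoothFunctions.

Context {M : manifold}.
Implicit Types f g X : smooth_fun M.

Lemma sf_ext f g : (forall x, f x = g x) -> f = g.
Proof.
destruct f as [f Hf], g as [g Hg]; simpl; intros E.
assert (f = g) as -> by (apply functional_extensionality, E).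
f_equal; apply proof_irrelevance.
Qed.

Lemma sf_derive_plus f g :
  sf_derive (sf_plus f g) = sf_plus (sf_derive f) (sf_derive g).
Proof.
apply sf_ext; intros x; simpl.
apply (Derive_plus f g); exact (smooth_ex_derive M _ x (sf_smooth _)).
Qed.

Lemma sf_derive_scal c f : sf_derive (sf_scal c f) = sf_scal c (sf_derive f).
Proof. apply sf_ext; intros x; simpl; apply (Derive_scal f). Qed.

Lemma sf_derive_mult f g :
  sf_derive (sf_mult f g) =
  sf_plus (sf_mult (sf_derive f) g) (sf_mult f (sf_derive g)).
Proof.
apply sf_ext; intros x; simpl.
apply (Derive_mult f g); exact (smooth_ex_derive M _ x (sf_smooth _)).
Qed.

Lemma Derive_trig (k a b x : R) :
  Derive (fun x => a * cos (k * x) + b * sin (k * x)) x =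
  (k * b) * cos (k * x) + - (k * a) * sin (k * x).
Proof. apply is_derive_unique; auto_derive; [exact I|]; ring. Qed.

(** Keeping both coefficients free makes the family stable under differentiation, as the induction
    requires; an integer frequency gives period [2 * PI] on the circle. *)
Lemma smooth_trig (k : nat) (a b : R) :
  smooth M (fun x => a * cos (INR k * x) + b * sin (INR k * x)).
Proof.
split.
- intros n; revert a b; induction n as [|n IH]; intros a b x; [exact I|].
  destruct n as [|n]; [simpl; auto_derive; exact I|].
  apply (proj2 (ex_derive_n_Derive _ n x)).
  apply ex_derive_n_ext with
    (fun x => (INR k * b) * cos (INR k * x) + - (INR k * a) * sin (INR k * x)).
  + intros t; symmetry; apply Derive_trig.
  + apply IH.
- destruct M; [exact I|]. intros x.
  replace (INR k * (x + 2 * PI)) with (INR k * x + 2 * INR k * PI) by ring.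
  rewrite cos_period, sin_period; reflexivity.
Qed.

Definition sf_trig (k : nat) (a b : R) : smooth_fun M :=
  SmoothFun _ (smooth_trig k a b).

Lemma smooth_const (c : R) : smooth M (fun _ => c).
Proof.
apply smooth_ext with (2 := smooth_trig 0 c 0).
intros x; simpl; rewrite Rmult_0_l, cos_0; ring.
Qed.

Definition sf_const (c : R) : smooth_fun M := SmoothFun _ (smooth_const c).

Lemma sf_derive_const c : sf_derive (sf_const c) = sf_const 0.
Proof. apply sf_ext; intros x; exact (Derive_const c x). Qed.

Lemma sf_derive_trig k a b :
  sf_derive (sf_trig k a b) = sf_trig k (INR k * b) (- (INR k * a)).
Proof. apply sf_ext; intros x; simpl; apply Derive_trig. Qed.

Lemma sf_derive_zero_const f : sf_derive f = sf_const 0 -> f = sf_const (f 0).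
Proof.
intros H; apply sf_ext; intros x; simpl.
assert (E : forall t, Derive f t = 0) by (intros t; exact (f_equal (fun g => sf_val g t) H)).
destruct (MVT_gen f 0 x (Derive f)) as [c [_ Hc]].
- intros t _; apply Derive_correct, (smooth_ex_derive M), sf_smooth.
- intros t _; apply derivable_continuous_pt, ex_derive_Reals_0,
    (smooth_ex_derive M), sf_smooth.
- rewrite E in Hc; lra.
Qed.

Lemma sf_prescribed_jet (x u0 u1 u2 : R) :
  exists t : smooth_fun M, t x = u0 /\ sf_derive t x = u1 /\
    sf_derive (sf_derive t) x = u2.
Proof.
(* This is [u0 + u2 - u2 cos (t - x) + u1 sin (t - x)] expanded in [t], which lives on the circle as
   well. *)
exists (sf_plus (sf_const (u0 + u2))
  (sf_trig 1 (- u2 * cos x - u1 * sin x) (- u2 * sin x + u1 * cos x))).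
rewrite !sf_derive_plus, !sf_derive_const, !sf_derive_trig.
cbn [sf_val sf_plus sf_const sf_trig INR]. rewrite !Rmult_1_l.
pose proof (sin2_cos2 x) as H; unfold Rsqr in H.
assert (E : sin x * sin x = 1 - cos x * cos x) by lra.
repeat split; ring [E].
Qed.

End SmoothFunctions.

#[global] Hint Rewrite @sf_derive_plus @sf_derive_scal @sf_derive_mult
  @sf_derive_const @sf_derive_trig : sf_derive.

Ltac sf_pointwise :=
  apply sf_ext; let x := fresh "x" in intros x; unfold lie_density;
  autorewrite with sf_derive;
  cbn [sf_val sf_plus sf_scal sf_mult sf_const].

(** * Operators as sextuples of coefficients *)

Section Jets.

Context {M : manifold}.

Record jet := Jet {
  c20 : smooth_fun M; c11 : smooth_fun M; c02 : smooth_fun M;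
  c10 : smooth_fun M; c01 : smooth_fun M; c00 : smooth_fun M
}.

Definition jet_of_coefs (a : nat -> nat -> smooth_fun M) : jet :=
  Jet (a 2 0)%nat (a 1 1)%nat (a 0 2)%nat (a 1 0)%nat (a 0 1)%nat (a 0 0)%nat.

Definition coefs (j : jet) (i k : nat) : smooth_fun M :=
  match i, k with
  | O, O => c00 j
  | 1%nat, O => c10 j
  | O, 1%nat => c01 j
  | 1%nat, 1%nat => c11 j
  | O, _ => c02 j
  | _, _ => c20 j
  end.

Definition op_of (j : jet) : operator M := fun f g =>
  let f1 := sf_derive f in let g1 := sf_derive g in
  sf_plus
    (sf_plus (sf_mult (c20 j) (sf_mult (sf_derive f1) g))
      (sf_plus (sf_mult (c11 j) (sf_mult f1 g1))
               (sf_mult (c02 j) (sf_mult f (sf_derive g1)))))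
    (sf_plus (sf_mult (c10 j) (sf_mult f1 g))
      (sf_plus (sf_mult (c01 j) (sf_mult f g1)) (sf_mult (c00 j) (sf_mult f g)))).

Definition jet_plus (u v : jet) : jet :=
  Jet (sf_plus (c20 u) (c20 v)) (sf_plus (c11 u) (c11 v))
      (sf_plus (c02 u) (c02 v)) (sf_plus (c10 u) (c10 v))
      (sf_plus (c01 u) (c01 v)) (sf_plus (c00 u) (c00 v)).

Definition jet_scal (c : R) (u : jet) : jet :=
  Jet (sf_scal c (c20 u)) (sf_scal c (c11 u)) (sf_scal c (c02 u))
      (sf_scal c (c10 u)) (sf_scal c (c01 u)) (sf_scal c (c00 u)).

Definition jet_lie (p : weights) (X : smooth_fun M) (u : jet) : jet :=
  jet_of_coefs (lie_coefs p X (coefs u)).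

Definition jet_iso (p q : weights) (F : jet -> jet) : Prop :=
  (forall u v, F (jet_plus u v) = jet_plus (F u) (F v)) /\
  (forall c u, F (jet_scal c u) = jet_scal c (F u)) /\
  (forall u v, F u = F v -> u = v) /\
  (forall v, exists u, F u = v) /\
  (forall X u, F (jet_lie p X u) = jet_lie q X (F u)).

Lemma op_ext (A B : operator M) :
  (forall f g x, A f g x = B f g x) -> A = B.
Proof.
intros H; apply functional_extensionality; intros f;
  apply functional_extensionality; intros g; apply sf_ext, H.
Qed.

Lemma jet_ext (u v : jet) :
  c20 u = c20 v -> c11 u = c11 v -> c02 u = c02 v ->
  c10 u = c10 v -> c01 u = c01 v -> c00 u = c00 v -> u = v.
Proof. destruct u, v; simpl; congruence. Qed.

Lemma has_coefs_op_of u : has_coefs (op_of u) (coefs u).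
Proof.
intros f g x; cbn [sum_f_R0 Nat.sub].
change (Derive_n f 2 x) with (sf_derive (sf_derive f) x).
change (Derive_n g 2 x) with (sf_derive (sf_derive g) x).
change (Derive_n f 1 x) with (sf_derive f x).
change (Derive_n g 1 x) with (sf_derive g x).
cbn [Derive_n op_of sf_val sf_plus sf_mult coefs].
ring.
Qed.

Lemma has_coefs_eq (A : operator M) a : has_coefs A a -> A = op_of (jet_of_coefs a).
Proof.
intros H; apply op_ext; intros f g x.
rewrite H, (has_coefs_op_of (jet_of_coefs a) f g x); reflexivity.
Qed.

Lemma bidiff2_op_of u : bidiff2 (op_of u).
Proof. exists (coefs u); apply has_coefs_op_of. Qed.

Lemma bidiff2_inv A : bidiff2 A -> exists u, A = op_of u.
Proof. intros [a Ha]; exists (jet_of_coefs a); apply has_coefs_eq, Ha. Qed.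

(** Functions whose 2-jets at [x] are basis vectors isolate one coefficient at [x] at a time. *)
Lemma op_of_inj u v : op_of u = op_of v -> u = v.
Proof.
intros H.
assert (E : forall f g x, op_of u f g x = op_of v f g x) by (rewrite H; reflexivity).
clear H. unfold op_of in E; cbn [sf_val sf_plus sf_mult] in E.
assert (V : forall x, c20 u x = c20 v x /\ c11 u x = c11 v x /\ c02 u x = c02 v x /\
  c10 u x = c10 v x /\ c01 u x = c01 v x /\ c00 u x = c00 v x).
{ intros x.
  destruct (sf_prescribed_jet (M := M) x 1 0 0) as [f [F0 [F1 F2]]].
  destruct (sf_prescribed_jet (M := M) x 0 1 0) as [g [G0 [G1 G2]]].
  destruct (sf_prescribed_jet (M := M) x 0 0 1) as [h [H0 [H1 H2]]].
  pose proof (E h f x) as E20; pose proof (E g g x) as E11;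
  pose proof (E f h x) as E02; pose proof (E g f x) as E10;
  pose proof (E f g x) as E01; pose proof (E f f x) as E00.
  rewrite ?F0, ?F1, ?F2, ?G0, ?G1, ?G2, ?H0, ?H1, ?H2 in *.
  repeat split; lra. }
apply jet_ext; apply sf_ext; intros x; apply V.
Qed.

Lemma op_of_plus u v : op_of (jet_plus u v) = op_plus (op_of u) (op_of v).
Proof. apply op_ext; intros f g x; simpl; ring. Qed.

Lemma op_of_scal c u : op_of (jet_scal c u) = op_scal c (op_of u).
Proof. apply op_ext; intros f g x; simpl; ring. Qed.

Lemma op_of_lie p X u : op_of (jet_lie p X u) = lie_op p X (op_of u).
Proof. symmetry; apply has_coefs_eq, has_coefs_lie_op, has_coefs_op_of. Qed.

(** By [op_of_inj] the choice is unique on [bidiff2] operators; elsewhere [epsilon] returns an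
    unspecified jet. *)
Definition jet_of (A : operator M) : jet :=
  epsilon (inhabits (Jet (sf_const 0) (sf_const 0) (sf_const 0)
                         (sf_const 0) (sf_const 0) (sf_const 0)))
    (fun u => A = op_of u).

Lemma op_of_jet_of A : bidiff2 A -> op_of (jet_of A) = A.
Proof. intros H; symmetry; exact (epsilon_spec _ _ (bidiff2_inv A H)). Qed.

Lemma jet_of_op_of u : jet_of (op_of u) = u.
Proof. apply op_of_inj, op_of_jet_of, bidiff2_op_of. Qed.

Definition on_operators (F : jet -> jet) : operator M -> operator M :=
  fun A => op_of (F (jet_of A)).

Lemma is_isomorphism_on_operators p q F :
  jet_iso p q F -> is_isomorphism p q (on_operators F).
Proof.
intros [Hp [Hs [Hi [Hr HL]]]]; unfold on_operators.
repeat split.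
- intros A _; apply bidiff2_op_of.
- intros A B HA HB.
  destruct (bidiff2_inv A HA) as [u ->], (bidiff2_inv B HB) as [v ->].
  rewrite <- op_of_plus, !jet_of_op_of, Hp; apply op_of_plus.
- intros c A HA; destruct (bidiff2_inv A HA) as [u ->].
  rewrite <- op_of_scal, !jet_of_op_of, Hs; apply op_of_scal.
- intros A B HA HB E.
  destruct (bidiff2_inv A HA) as [u ->], (bidiff2_inv B HB) as [v ->].
  rewrite !jet_of_op_of in E; f_equal; apply Hi, op_of_inj, E.
- intros B HB; destruct (bidiff2_inv B HB) as [v ->], (Hr v) as [u Hu].
  exists (op_of u); split; [apply bidiff2_op_of|].
  rewrite jet_of_op_of, Hu; reflexivity.
- intros X A HA; destruct (bidiff2_inv A HA) as [u ->].
  rewrite <- op_of_lie, !jet_of_op_of, HL; apply op_of_lie.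
Qed.

Lemma jet_iso_of_isomorphic p q :
  isomorphic M p q -> exists F, jet_iso p q F.
Proof.
intros [T [Hb [Hp [Hs [Hi [Hr HL]]]]]].
assert (HB := bidiff2_op_of).
assert (J : forall u, exists v, T (op_of u) = op_of v) by
  (intros u; apply bidiff2_inv, Hb, HB).
exists (fun u => jet_of (T (op_of u))); repeat split.
- intros u v; rewrite op_of_plus, Hp by auto.
  destruct (J u) as [u' ->], (J v) as [v' ->].
  rewrite <- op_of_plus, !jet_of_op_of; reflexivity.
- intros c u; rewrite op_of_scal, Hs by auto.
  destruct (J u) as [u' ->].
  rewrite <- op_of_scal, !jet_of_op_of; reflexivity.
- intros u v E; apply op_of_inj, Hi; auto.
  destruct (J u) as [u' Eu], (J v) as [v' Ev].
  rewrite Eu, Ev, !jet_of_op_of in *; congruence.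
- intros v; destruct (Hr (op_of v) (HB v)) as [A [HA E]].
  destruct (bidiff2_inv A HA) as [u ->].
  exists u; rewrite E; apply jet_of_op_of.
- intros X u; rewrite op_of_lie, HL by auto.
  destruct (J u) as [u' ->].
  rewrite <- op_of_lie, !jet_of_op_of; reflexivity.
Qed.

End Jets.
Arguments jet : clear implicits.

(** * Small matrices *)

(** Vectors and matrices are functions on [nat] of which only the entries below the size count,
    whence the bounds in the statements about them. *)
Definition dot2 (u v : nat -> R) : R := u 0%nat * v 0%nat + u 1%nat * v 1%nat.

Definition dot3 (u v : nat -> R) : R :=
  u 0%nat * v 0%nat + u 1%nat * v 1%nat + u 2%nat * v 2%nat.

Definition mul2 (A B : nat -> nat -> R) (i k : nat) : R :=
  dot2 (A i) (fun l => B l k).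

Definition mul3 (A B : nat -> nat -> R) (i k : nat) : R :=
  dot3 (A i) (fun l => B l k).

Definition id_mat (i k : nat) : R := if Nat.eqb i k then 1 else 0.

Definition inverse2 (A B : nat -> nat -> R) : Prop :=
  forall i k, (i < 2)%nat -> (k < 2)%nat ->
    mul2 A B i k = id_mat i k /\ mul2 B A i k = id_mat i k.

Definition inverse3 (A B : nat -> nat -> R) : Prop :=
  forall i k, (i < 3)%nat -> (k < 3)%nat ->
    mul3 A B i k = id_mat i k /\ mul3 B A i k = id_mat i k.

Definition vec2 (a b : R) (i : nat) : R := match i with O => a | _ => b end.

Definition vec3 (a b c : R) (i : nat) : R :=
  match i with O => a | 1%nat => b | _ => c end.

Definition rows2 {T : Type} (u v : T) (i : nat) : T :=
  match i with O => u | _ => v end.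

Definition rows3 {T : Type} (u v w : T) (i : nat) : T :=
  match i with O => u | 1%nat => v | _ => w end.

Ltac below3 i := destruct i as [|[|[|i]]]; [| | |exfalso; lia].
Ltac below2 i := destruct i as [|[|i]]; [| |exfalso; lia].

Lemma inverse2_exists (A : nat -> nat -> R) :
  A 0%nat 0%nat * A 1%nat 1%nat - A 0%nat 1%nat * A 1%nat 0%nat <> 0 ->
  exists B, inverse2 A B.
Proof.
set (D := _ - _); intros HD.
exists (rows2 (vec2 (A 1%nat 1%nat / D) (- A 0%nat 1%nat / D))
              (vec2 (- A 1%nat 0%nat / D) (A 0%nat 0%nat / D))).
intros i k Hi Hk; below2 i; below2 k; split;
  unfold mul2, dot2, id_mat; simpl; unfold D; field; exact HD.
Qed.

Definition det3 (A : nat -> nat -> R) : R :=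
  A 0%nat 0%nat * (A 1%nat 1%nat * A 2%nat 2%nat - A 1%nat 2%nat * A 2%nat 1%nat)
  - A 0%nat 1%nat * (A 1%nat 0%nat * A 2%nat 2%nat - A 1%nat 2%nat * A 2%nat 0%nat)
  + A 0%nat 2%nat * (A 1%nat 0%nat * A 2%nat 1%nat - A 1%nat 1%nat * A 2%nat 0%nat).

Lemma inverse3_exists (A : nat -> nat -> R) :
  det3 A <> 0 -> exists B, inverse3 A B.
Proof.
intros HD.
(* [m i j k l] is the minor on rows [i], [k] and columns [j], [l], divided by the determinant; the
   witness is the adjugate formula. *)
pose (m := fun i j k l => (A i j * A k l - A i l * A k j) / det3 A).
exists (rows3 (vec3 (m 1 1 2 2)%nat (- m 0 1 2 2)%nat (m 0 1 1 2)%nat)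
              (vec3 (- m 1 0 2 2)%nat (m 0 0 2 2)%nat (- m 0 0 1 2)%nat)
              (vec3 (m 1 0 2 1)%nat (- m 0 0 2 1)%nat (m 0 0 1 1)%nat)).
intros i k Hi Hk; below3 i; below3 k; split;
  unfold mul3, dot3, id_mat; simpl; unfold m, det3 in *; field; exact HD.
Qed.

Lemma mul3_assoc A B C i k : mul3 (mul3 A B) C i k = mul3 A (mul3 B C) i k.
Proof. unfold mul3, dot3; ring. Qed.

Lemma mul3_ext A A' B B' i k :
  (forall l, (l < 3)%nat -> A i l = A' i l) ->
  (forall l, (l < 3)%nat -> B l k = B' l k) -> mul3 A B i k = mul3 A' B' i k.
Proof. intros HA HB; unfold mul3, dot3; rewrite !HA, !HB by lia; reflexivity. Qed.

Lemma mul3_id_l A i k : (i < 3)%nat -> mul3 id_mat A i k = A i k.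
Proof. intros Hi; below3 i; unfold mul3, dot3, id_mat; simpl; ring. Qed.

Lemma inverse3_sym A B : inverse3 A B -> inverse3 B A.
Proof. intros H i k Hi Hk; split; apply (H i k Hi Hk). Qed.

Lemma inverse3_mul A A' B B' :
  inverse3 A A' -> inverse3 B B' -> inverse3 (mul3 A B) (mul3 B' A').
Proof.
assert (half : forall A A' B B', inverse3 A A' -> inverse3 B B' ->
  forall i k, (i < 3)%nat -> (k < 3)%nat ->
  mul3 (mul3 A B) (mul3 B' A') i k = id_mat i k).
{ intros U U' V V' HU HV i k Hi Hk.
  rewrite mul3_assoc.
  rewrite (mul3_ext U U (mul3 V (mul3 V' U')) U'); [apply HU; auto|auto|].
  intros l Hl; rewrite <- mul3_assoc.
  rewrite (mul3_ext (mul3 V V') id_mat U' U'); [apply mul3_id_l; auto| |auto].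
  intros l' Hl'; apply HV; auto. }
intros HA HB i k Hi Hk; split; apply half; auto using inverse3_sym.
Qed.

Lemma inverse3_solve A B B' :
  inverse3 B B' -> forall i k, (i < 3)%nat -> mul3 B (mul3 B' A) i k = A i k.
Proof.
intros HB i k Hi; rewrite <- mul3_assoc, (mul3_ext _ id_mat A A);
  [apply mul3_id_l; auto| |auto].
intros l Hl; apply HB; auto.
Qed.

(** A nonzero row extends to a basis by the two standard rows that avoid a coordinate where it does
    not vanish. *)
Lemma exists_first_row (w : nat -> R) :
  ~ (w 0%nat = 0 /\ w 1%nat = 0 /\ w 2%nat = 0) ->
  exists A B, inverse3 A B /\ A 0%nat = w.
Proof.
intros Hw.
assert (J : exists u v, det3 (rows3 w u v) <> 0).
{ destruct (Req_dec (w 0%nat) 0) as [H0|H0]; [destruct (Req_dec (w 1%nat) 0) as [H1|H1]|].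
  - exists (vec3 1 0 0), (vec3 0 1 0); unfold det3; simpl.
    intros E; apply Hw; repeat split; auto; lra.
  - exists (vec3 1 0 0), (vec3 0 0 1); unfold det3; simpl; lra.
  - exists (vec3 0 1 0), (vec3 0 0 1); unfold det3; simpl; lra. }
destruct J as [u [v J]], (inverse3_exists _ J) as [B HB].
exists (rows3 w u v), B; split; [exact HB|reflexivity].
Qed.

(** If [U] and [V] are invertible with first rows [w] and [w'], then [V^-1 U] works, since
    [V (V^-1 U) = U]. *)
Lemma exists_row_transport (w w' : nat -> R) :
  ~ (w 0%nat = 0 /\ w 1%nat = 0 /\ w 2%nat = 0) ->
  ~ (w' 0%nat = 0 /\ w' 1%nat = 0 /\ w' 2%nat = 0) ->
  exists A B, inverse3 A B /\
    forall k, (k < 3)%nat -> dot3 w' (fun l => A l k) = w k.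
Proof.
intros Hw Hw'.
destruct (exists_first_row w Hw) as [U [U' [HU <-]]].
destruct (exists_first_row w' Hw') as [V [V' [HV <-]]].
exists (mul3 V' U), (mul3 U' V); split.
- apply inverse3_mul; auto using inverse3_sym.
- intros k Hk; exact (inverse3_solve U V V' HV 0 k ltac:(lia)).
Qed.

(** * Equivariant differential operators between the modules *)

(** In these terms [lie_coefs] acts on the second, first and zeroth order
    coefficients [a], [b], [c] by
    [L a], [L b + X'' P a] and [L c + X'' Q b + X''' S a]. *)
Definition Pmat (p : weights) : nat -> nat -> R :=
  rows2 (vec3 (- (1 + 2 * wt1 p)) (- wt2 p) 0)
        (vec3 0 (- wt1 p) (- (1 + 2 * wt2 p))).

Definition Qrow (p : weights) : nat -> R := vec2 (- wt1 p) (- wt2 p).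

Definition Srow (p : weights) : nat -> R := vec3 (- wt1 p) 0 (- wt2 p).

Section Transforms.

Context {M : manifold}.

Definition comb2 (r : nat -> R) (f g : smooth_fun M) : smooth_fun M :=
  sf_plus (sf_scal (r 0%nat) f) (sf_scal (r 1%nat) g).

Definition comb3 (r : nat -> R) (f g h : smooth_fun M) : smooth_fun M :=
  sf_plus (comb2 r f g) (sf_scal (r 2%nat) h).

(** A derivative raises the weight by one, so the weights [delta - 2], [delta - 1], [delta] of the
    three levels dictate the order of differentiation in each term. *)
Definition transform (A B : nat -> nat -> R) (c : R) (N : nat -> nat -> R)
    (K L : nat -> R) (u : jet M) : jet M :=
  let D := sf_derive in
  let a i := comb3 (A i) (c20 u) (c11 u) (c02 u) in
  let b i := sf_plus (comb2 (B i) (c10 u) (c01 u))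
                     (comb3 (N i) (D (c20 u)) (D (c11 u)) (D (c02 u))) in
  Jet (a 0%nat) (a 1%nat) (a 2%nat) (b 0%nat) (b 1%nat)
    (sf_plus (sf_scal c (c00 u))
      (sf_plus (comb2 K (D (c10 u)) (D (c01 u)))
        (comb3 L (D (D (c20 u))) (D (D (c11 u))) (D (D (c02 u)))))).

(** The equations compare the coefficients of [X'' a] at order one, then those of [X'' b], [X'' a']
    and [X''' a] at order zero. The factor [2 d - 3] is the coefficient of [X'' a'] in the second
    derivative of the Lie derivative of [a] at weight [d - 2]. *)
Definition intertwining (p q : weights) (A B : nat -> nat -> R) (c : R)
    (N : nat -> nat -> R) (K L : nat -> R) : Prop :=
  let d := delta p in
  (forall i k, (i < 2)%nat -> (k < 3)%nat ->
    dot2 (B i) (fun j => Pmat p j k) + (d - 2) * N i k =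
    dot3 (Pmat q i) (fun l => A l k)) /\
  (forall i, (i < 2)%nat ->
    c * Qrow p i + (d - 1) * K i = dot2 (Qrow q) (fun j => B j i)) /\
  (forall k, (k < 3)%nat ->
    dot2 K (fun j => Pmat p j k) + (2 * d - 3) * L k =
    dot2 (Qrow q) (fun j => N j k)) /\
  (forall k, (k < 3)%nat ->
    c * Srow p k + dot2 K (fun j => Pmat p j k) + (d - 2) * L k =
    dot3 (Srow q) (fun l => A l k)).

Lemma comb2_inverse A B i (f g : smooth_fun M) :
  inverse2 A B -> (i < 2)%nat ->
  comb2 (A i) (comb2 (B 0%nat) f g) (comb2 (B 1%nat) f g) = rows2 f g i.
Proof.
intros H Hi; apply sf_ext; intros x.
transitivity (mul2 A B i 0%nat * f x + mul2 A B i 1%nat * g x).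
- unfold mul2, dot2; simpl; ring.
- rewrite (proj1 (H i 0%nat Hi ltac:(lia))), (proj1 (H i 1%nat Hi ltac:(lia))).
  below2 i; unfold id_mat; simpl; ring.
Qed.

Lemma comb3_inverse A B i (f g h : smooth_fun M) :
  inverse3 A B -> (i < 3)%nat ->
  comb3 (A i) (comb3 (B 0%nat) f g h) (comb3 (B 1%nat) f g h)
    (comb3 (B 2%nat) f g h) = rows3 f g h i.
Proof.
intros H Hi; apply sf_ext; intros x.
transitivity (mul3 A B i 0%nat * f x + mul3 A B i 1%nat * g x
              + mul3 A B i 2%nat * h x).
- unfold mul3, dot3; simpl; ring.
- rewrite (proj1 (H i 0%nat Hi ltac:(lia))), (proj1 (H i 1%nat Hi ltac:(lia))),
    (proj1 (H i 2%nat Hi ltac:(lia))).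
  below3 i; unfold id_mat; simpl; ring.
Qed.

Lemma sf_plus_cancel_r (f g h : smooth_fun M) : sf_plus f h = sf_plus g h -> f = g.
Proof.
intros E; apply sf_ext; intros x.
pose proof (f_equal (fun k => sf_val k x) E) as H; simpl in H; lra.
Qed.

Lemma sf_minus_plus (f g : smooth_fun M) :
  sf_plus (sf_plus f (sf_scal (-1) g)) g = f.
Proof. apply sf_ext; intros x; simpl; ring. Qed.

(** The map is block triangular with invertible diagonal blocks [A], [B], [c]: the coefficients are
    recovered from order two downwards. *)
Lemma transform_inj A A' B B' c N K L (u v : jet M) :
  inverse3 A A' -> inverse2 B B' -> c <> 0 ->
  transform A B c N K L u = transform A B c N K L v -> u = v.
Proof.
intros HA HB Hc E.
destruct u as [u20 u11 u02 u10 u01 u00], v as [v20 v11 v02 v10 v01 v00].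
pose proof (f_equal c20 E) as E0; pose proof (f_equal c11 E) as E1;
  pose proof (f_equal c02 E) as E2; pose proof (f_equal c10 E) as F0;
  pose proof (f_equal c01 E) as F1; pose proof (f_equal c00 E) as G.
unfold transform in E0, E1, E2, F0, F1, G;
  cbn [c20 c11 c02 c10 c01 c00] in *; clear E.
assert (R : forall i, (i < 3)%nat -> rows3 u20 u11 u02 i = rows3 v20 v11 v02 i).
{ intros i Hi.
  rewrite <- !(comb3_inverse A' A i _ _ _ (inverse3_sym _ _ HA) Hi); congruence. }
pose proof (R 0%nat ltac:(lia)) as R0; pose proof (R 1%nat ltac:(lia)) as R1;
  pose proof (R 2%nat ltac:(lia)) as R2; simpl in R0, R1, R2; subst.
apply sf_plus_cancel_r in F0, F1.
assert (HB' : inverse2 B' B) by (intros i k Hi Hk; split; apply (HB i k Hi Hk)).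
assert (T : forall i, (i < 2)%nat -> rows2 u10 u01 i = rows2 v10 v01 i).
{ intros i Hi; rewrite <- !(comb2_inverse B' B i _ _ HB' Hi); congruence. }
pose proof (T 0%nat ltac:(lia)) as T0; pose proof (T 1%nat ltac:(lia)) as T1;
  simpl in T0, T1; subst.
apply sf_plus_cancel_r in G.
f_equal; apply sf_ext; intros x; apply (Rmult_eq_reg_l c); auto.
exact (f_equal (fun f => sf_val f x) G).
Qed.

Lemma transform_surj A A' B B' c N K L (v : jet M) :
  inverse3 A A' -> inverse2 B B' -> c <> 0 ->
  exists u, transform A B c N K L u = v.
Proof.
intros HA HB Hc; destruct v as [v20 v11 v02 v10 v01 v00].
pose (a i := comb3 (A' i) v20 v11 v02).
pose (n i := comb3 (N i) (sf_derive (a 0%nat)) (sf_derive (a 1%nat))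
                         (sf_derive (a 2%nat))).
pose (w0 := sf_plus v10 (sf_scal (-1) (n 0%nat))).
pose (w1 := sf_plus v01 (sf_scal (-1) (n 1%nat))).
pose (b i := comb2 (B' i) w0 w1).
exists (Jet (a 0%nat) (a 1%nat) (a 2%nat) (b 0%nat) (b 1%nat)
  (sf_scal (/ c) (sf_plus v00 (sf_scal (-1)
    (sf_plus (comb2 K (sf_derive (b 0%nat)) (sf_derive (b 1%nat)))
      (comb3 L (sf_derive (sf_derive (a 0%nat))) (sf_derive (sf_derive (a 1%nat)))
               (sf_derive (sf_derive (a 2%nat))))))))).
unfold transform; cbn [c20 c11 c02 c10 c01 c00].
f_equal;
  [apply (comb3_inverse A A' 0 v20 v11 v02) | apply (comb3_inverse A A' 1 v20 v11 v02)
  |apply (comb3_inverse A A' 2 v20 v11 v02) | | | ]; auto.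
- transitivity (sf_plus w0 (n 0%nat)); [f_equal|apply sf_minus_plus].
  apply (comb2_inverse B B' 0 w0 w1); auto.
- transitivity (sf_plus w1 (n 1%nat)); [f_equal|apply sf_minus_plus].
  apply (comb2_inverse B B' 1 w0 w1); auto.
- apply sf_ext; intros x; simpl; field; exact Hc.
Qed.

Lemma transform_plus A B c N K L (u v : jet M) :
  transform A B c N K L (jet_plus u v) =
  jet_plus (transform A B c N K L u) (transform A B c N K L v).
Proof.
apply jet_ext; unfold transform, jet_plus, comb3, comb2;
  cbn [c20 c11 c02 c10 c01 c00]; sf_pointwise; ring.
Qed.

Lemma transform_scal A B c N K L s (u : jet M) :
  transform A B c N K L (jet_scal s u) = jet_scal s (transform A B c N K L u).
Proof.
apply jet_ext; unfold transform, jet_scal, comb3, comb2;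
  cbn [c20 c11 c02 c10 c01 c00]; sf_pointwise; ring.
Qed.

Lemma transform_lie p q A B c N K L (X : smooth_fun M) u :
  delta p = delta q -> intertwining p q A B c N K L ->
  transform A B c N K L (jet_lie p X u) = jet_lie q X (transform A B c N K L u).
Proof.
intros Hd [H1 [H2 [H3 H4]]].
pose proof (fun i Hi => H1 i 0%nat Hi ltac:(lia)) as H10.
pose proof (fun i Hi => H1 i 1%nat Hi ltac:(lia)) as H11.
pose proof (fun i Hi => H1 i 2%nat Hi ltac:(lia)) as H12.
pose proof (H2 0%nat ltac:(lia)) as H20; pose proof (H2 1%nat ltac:(lia)) as H21.
pose proof (H3 0%nat ltac:(lia)) as H30; pose proof (H3 1%nat ltac:(lia)) as H31;
  pose proof (H3 2%nat ltac:(lia)) as H32.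
pose proof (H4 0%nat ltac:(lia)) as H40; pose proof (H4 1%nat ltac:(lia)) as H41;
  pose proof (H4 2%nat ltac:(lia)) as H42.
clear H1 H2 H3 H4.
destruct u as [a0 a1 a2 b0 b1 e].
apply jet_ext; unfold jet_lie, jet_of_coefs, lie_coefs, transform, comb3, comb2;
  cbn [c20 c11 c02 c10 c01 c00 coefs]; rewrite <- Hd; sf_pointwise.
- ring.
- ring.
- ring.
- specialize (H10 0%nat ltac:(lia)); specialize (H11 0%nat ltac:(lia));
    specialize (H12 0%nat ltac:(lia)).
  unfold dot2, dot3, Pmat in *; cbn [rows2 vec3] in *.
  apply Rminus_diag_uniq.
  (* The difference of the two sides is a combination of the residuals of the equations, which the
     [match] reads off the hypotheses so that [ring] can check it. *)
  match type of H10 with ?l0 = ?r0 => match type of H11 with ?l1 = ?r1 =>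
  match type of H12 with ?l2 = ?r2 =>
  transitivity (sf_derive (sf_derive X) x *
    ((l0 - r0) * a0 x + (l1 - r1) * a1 x + (l2 - r2) * a2 x)); [ring|] end end end.
  rewrite H10, H11, H12; ring.
- specialize (H10 1%nat ltac:(lia)); specialize (H11 1%nat ltac:(lia));
    specialize (H12 1%nat ltac:(lia)).
  unfold dot2, dot3, Pmat in *; cbn [rows2 vec3] in *.
  apply Rminus_diag_uniq.
  match type of H10 with ?l0 = ?r0 => match type of H11 with ?l1 = ?r1 =>
  match type of H12 with ?l2 = ?r2 =>
  transitivity (sf_derive (sf_derive X) x *
    ((l0 - r0) * a0 x + (l1 - r1) * a1 x + (l2 - r2) * a2 x)); [ring|] end end end.
  rewrite H10, H11, H12; ring.
- unfold dot2, dot3, Pmat, Qrow, Srow in *; cbn [rows2 vec3 vec2] in *.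
  apply Rminus_diag_uniq.
  match type of H20 with ?k0 = ?s0 => match type of H21 with ?k1 = ?s1 =>
  match type of H30 with ?l0 = ?r0 => match type of H31 with ?l1 = ?r1 =>
  match type of H32 with ?l2 = ?r2 =>
  match type of H40 with ?m0 = ?t0 => match type of H41 with ?m1 = ?t1 =>
  match type of H42 with ?m2 = ?t2 =>
  transitivity (sf_derive (sf_derive X) x *
    ((k0 - s0) * b0 x + (k1 - s1) * b1 x
     + (l0 - r0) * sf_derive a0 x + (l1 - r1) * sf_derive a1 x
     + (l2 - r2) * sf_derive a2 x)
    + sf_derive (sf_derive (sf_derive X)) x *
    ((m0 - t0) * a0 x + (m1 - t1) * a1 x + (m2 - t2) * a2 x));
    [ring|] end end end end end end end end.
  rewrite H20, H21, H30, H31, H32, H40, H41, H42; ring.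
Qed.

Lemma transform_iso p q A A' B B' c N K L :
  delta p = delta q -> inverse3 A A' -> inverse2 B B' -> c <> 0 ->
  intertwining p q A B c N K L ->
  jet_iso p q (@transform A B c N K L).
Proof.
intros Hd HA HB Hc H; repeat split.
- apply transform_plus.
- apply transform_scal.
- intros u v; apply (transform_inj A A' B B'); auto.
- intros v; apply (transform_surj A A' B B'); auto.
- intros X u; apply transform_lie; auto.
Qed.

End Transforms.

(** * Conjugation and permutation *)

Section Conjugation.

Context {M : manifold}.

Lemma is_RInt_sf_derive (f : smooth_fun M) a b :
  is_RInt (sf_derive f) a b (f b - f a).
Proof.
apply (is_RInt_derive f (Derive f)).
- intros x _; apply Derive_correct, (smooth_ex_derive M), sf_smooth.
- intros x _; apply (ex_derive_continuous (Derive f)).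
  exact (smooth_ex_derive M _ x (sf_smooth (sf_derive f))).
Qed.

Lemma compactly_supported_derive (f : smooth_fun M) :
  compactly_supported f -> compactly_supported (sf_derive f).
Proof.
unfold compactly_supported; destruct M; [|auto].
intros [a [b H]]; exists a, b; intros x Hx; simpl.
rewrite (Derive_ext_loc f (fun _ => 0)); [apply Derive_const|].
destruct Hx as [Hx|Hx].
- apply filter_imp with (P := fun t => t < a); [auto|apply (open_lt a); exact Hx].
- apply filter_imp with (P := fun t => b < t); [auto|apply (open_gt b); exact Hx].
Qed.

Lemma compactly_supported_mult_l (f g : smooth_fun M) :
  compactly_supported f -> compactly_supported (sf_mult f g).
Proof.
unfold compactly_supported; destruct M; [|auto].
intros [a [b H]]; exists a, b; intros x Hx; simpl; rewrite H; auto; ring.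
Qed.

Lemma compactly_supported_plus (f g : smooth_fun M) :
  compactly_supported f -> compactly_supported g ->
  compactly_supported (sf_plus f g).
Proof.
unfold compactly_supported; destruct M; [|auto].
intros [a [b Hf]] [a' [b' Hg]]; exists (Rmin a a'), (Rmax b b'); intros x Hx; simpl.
rewrite Hf, Hg; [ring| |]; destruct Hx as [Hx|Hx];
  pose proof (Rmin_l a a'); pose proof (Rmin_r a a');
  pose proof (Rmax_l b b'); pose proof (Rmax_r b b'); lra.
Qed.

End Conjugation.

Lemma is_RInt_plus_derive {M} (f g W : smooth_fun M) x y l :
  g = sf_plus f (sf_derive W) -> W x = W y -> is_RInt f x y l -> is_RInt g x y l.
Proof.
intros -> E H.
replace l with (plus l (W y - W x)) by (rewrite E; unfold plus; simpl; ring).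
apply (is_RInt_plus f (sf_derive W)); [exact H|apply is_RInt_sf_derive].
Qed.

Lemma is_RInt_gen_plus_derive (f g W : smooth_fun Line) l :
  g = sf_plus f (sf_derive W) -> compactly_supported W ->
  is_RInt_gen f (Rbar_locally m_infty) (Rbar_locally p_infty) l ->
  is_RInt_gen g (Rbar_locally m_infty) (Rbar_locally p_infty) l.
Proof.
intros E [a [b HW]]; apply filterlimi_ext_loc.
exists (fun x => x < a) (fun x => b < x);
  [exists a; auto|exists b; auto|].
intros x y Hx Hy l'; simpl.
split; intros H.
- apply (is_RInt_plus_derive f g W); auto; rewrite !HW; auto.
- apply (is_RInt_plus_derive g f (sf_scal (-1) W)); auto.
  + rewrite E, sf_derive_scal; apply sf_ext; intros t; simpl; ring.
  + simpl; rewrite !HW; auto.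
Qed.

(** [RInt] and [RInt_gen] select a value from a predicate, and the two predicates are equivalent:
    the boundary terms of [W] vanish far out on the line and cancel by periodicity on the circle. *)
Lemma integral_plus_derive {M} (f g W : smooth_fun M) :
  g = sf_plus f (sf_derive W) -> compactly_supported W -> integral f = integral g.
Proof.
intros E HW.
assert (E' : f = sf_plus g (sf_derive (sf_scal (-1) W))) by
  (rewrite E, sf_derive_scal; apply sf_ext; intros t; simpl; ring).
destruct M; simpl in *.
- unfold RInt_gen; f_equal.
  apply functional_extensionality; intros l; apply propositional_extensionality.
  split; apply is_RInt_gen_plus_derive with (1 := E)
    || apply is_RInt_gen_plus_derive with (1 := E'); auto.
  destruct HW as [a [b HW]]; exists a, b; intros x Hx; simpl; rewrite HW; auto; ring.
- assert (P : W 0 = W (2 * PI)) by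
    (rewrite <- (proj2 (sf_smooth W) 0); f_equal; ring).
  unfold RInt; f_equal.
  apply functional_extensionality; intros l; apply propositional_extensionality.
  split; intros H.
  + apply (is_RInt_plus_derive f g W); auto.
  + apply (is_RInt_plus_derive g f (sf_scal (-1) W)); auto; simpl; rewrite P; auto.
Qed.

(** The conjugation matrices come from integrating by parts off the first argument: they expand
    [(c20 g h)'' - (c11 g' h)' - (c10 g h)' + c02 g'' h + c01 g' h + c00 g h] in the derivatives of
    [g] and [h]. *)
Definition conj_top : nat -> nat -> R :=
  rows3 (vec3 1 (-1) 1) (vec3 2 (-1) 0) (vec3 1 0 0).
Definition conj_mid : nat -> nat -> R := rows2 (vec2 (-1) 1) (vec2 (-1) 0).
Definition conj_mid' : nat -> nat -> R := rows2 (vec3 2 (-1) 0) (vec3 2 0 0).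

Definition jet_conj {M} : jet M -> jet M :=
  transform conj_top conj_mid 1 conj_mid' (vec2 (-1) 0) (vec3 1 0 0).

Ltac check_intertwining :=
  unfold intertwining, delta; repeat split;
  [intros i k Hi Hk; below2 i; below3 k | intros i Hi; below2 i
  |intros k Hk; below3 k | intros k Hk; below3 k];
  unfold dot2, dot3; simpl; ring.

Lemma jet_conj_iso {M} (p : weights) : jet_iso p (wt_conj p) (@jet_conj M).
Proof.
destruct (inverse3_exists conj_top) as [A' HA]; [unfold det3; simpl; lra|].
destruct (inverse2_exists conj_mid) as [B' HB]; [simpl; lra|].
apply (transform_iso _ _ _ A' _ B'); auto with real.
- unfold delta, wt_conj; simpl; ring.
- check_intertwining.
Qed.

(** [A(f, g) h - f A*(g, h)] is the derivative of
    [f g1 + f' g2 - f g2'], where [A(f, g) h = f g0 + f' g1 + f'' g2]. *)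
Lemma is_conjugation_jet_conj M : @is_conjugation M (on_operators jet_conj).
Proof.
intros A HA; split; [apply bidiff2_op_of|].
destruct (bidiff2_inv A HA) as [u ->]; intros f g h Hf Hg Hh.
unfold on_operators; rewrite jet_of_op_of.
symmetry.
pose (g1 := sf_mult (sf_plus (sf_mult (c10 u) g) (sf_mult (c11 u) (sf_derive g))) h).
pose (g2 := sf_mult (sf_mult (c20 u) g) h).
apply (integral_plus_derive _ _
  (sf_plus (sf_mult f (sf_plus g1 (sf_scal (-1) (sf_derive g2))))
           (sf_mult (sf_derive f) g2))).
- destruct u as [u20 u11 u02 u10 u01 u00].
  unfold g1, g2, op_of, jet_conj, transform, comb3, comb2;
    cbn [c20 c11 c02 c10 c01 c00]; sf_pointwise.
  cbn; ring.
- auto using compactly_supported_plus, compactly_supported_mult_l,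
    compactly_supported_derive.
Qed.

Definition jet_permute {M} : jet M -> jet M :=
  transform (rows3 (vec3 0 0 1) (vec3 0 1 0) (vec3 1 0 0))
    (rows2 (vec2 0 1) (vec2 1 0)) 1 (fun _ _ => 0) (fun _ => 0) (fun _ => 0).

Lemma jet_permute_iso {M} (p : weights) : jet_iso p (wt_permute p) (@jet_permute M).
Proof.
destruct (inverse3_exists (rows3 (vec3 0 0 1) (vec3 0 1 0) (vec3 1 0 0)))
  as [A' HA]; [unfold det3; simpl; lra|].
destruct (inverse2_exists (rows2 (vec2 0 1) (vec2 1 0))) as [B' HB]; [simpl; lra|].
apply (transform_iso _ _ _ A' _ B'); auto with real.
- unfold delta, wt_permute; simpl; ring.
- check_intertwining.
Qed.

Lemma is_isomorphism_comp {M} p q r (T S : operator M -> operator M) :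
  is_isomorphism p q T -> is_isomorphism q r S ->
  is_isomorphism p r (fun A => S (T A)).
Proof.
intros [Tb [Tp [Ts [Ti [Tr TL]]]]] [Sb [Sp [Ss [Si [Sr SL]]]]].
repeat split.
- auto.
- intros A B HA HB; rewrite Tp, Sp; auto.
- intros c A HA; rewrite Ts, Ss; auto.
- intros A B HA HB E; apply Ti; auto.
- intros C HC; destruct (Sr C HC) as [B [HB <-]], (Tr B HB) as [A [HA <-]]; eauto.
- intros X A HA; rewrite TL, SL; auto.
Qed.

Lemma is_isomorphism_id {M} p : is_isomorphism p p (fun A : operator M => A).
Proof. repeat split; eauto. Qed.

Lemma isomorphic_trans M p q r :
  isomorphic M p q -> isomorphic M q r -> isomorphic M p r.
Proof. intros [T HT] [S HS]; exists (fun A => S (T A)); eapply is_isomorphism_comp; eauto. Qed.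

Lemma isomorphic_of_jet_iso M p q (F : jet M -> jet M) :
  jet_iso p q F -> isomorphic M p q.
Proof. intros H; exists (on_operators F); apply is_isomorphism_on_operators, H. Qed.

Lemma conj_perm_isomorphic_conj M p q :
  conj_perm_isomorphic M p q -> conj_perm_isomorphic M p (wt_conj q).
Proof.
intros [T [HT HI]]; exists (fun A => on_operators jet_conj (T A)); split.
- apply cp_conj; [exact HT|apply is_conjugation_jet_conj].
- eapply is_isomorphism_comp; [exact HI|].
  apply is_isomorphism_on_operators, jet_conj_iso.
Qed.

Lemma conj_perm_isomorphic_refl M p : conj_perm_isomorphic M p p.
Proof. exists (fun A => A); split; [constructor|apply is_isomorphism_id]. Qed.

Lemma isomorphic_conj M p : isomorphic M p (wt_conj p).
Proof. exact (isomorphic_of_jet_iso _ _ _ _ (jet_conj_iso p)). Qed.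

Lemma isomorphic_permute M p : isomorphic M p (wt_permute p).
Proof. exact (isomorphic_of_jet_iso _ _ _ _ (jet_permute_iso p)). Qed.

Lemma wt_conj_three p : wt_conj (wt_conj (wt_conj p)) = p.
Proof. destruct p; unfold wt_conj; simpl; f_equal; ring. Qed.

Lemma isomorphic_conj_inv M p : isomorphic M (wt_conj p) p.
Proof.
rewrite <- (wt_conj_three p) at 2.
eapply isomorphic_trans; apply isomorphic_conj.
Qed.

(** Conjugation has order three on the weights, so at most two conjugations lead from any point of
    an orbit to any other. Each of the three lists of weights is such an orbit. *)
Lemma conj_orbit_isomorphic M p q r :
  wt_conj p = q -> wt_conj q = r ->
  forall u v, In u [p; q; r] -> In v [p; q; r] -> conj_perm_isomorphic M u v.
Proof.
intros <- <- u v Hu Hv.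
assert (E := wt_conj_three).
assert (step : forall u v, v = u \/ v = wt_conj u \/ v = wt_conj (wt_conj u) ->
  conj_perm_isomorphic M u v).
{ intros a b [->|[->| ->]];
    repeat apply conj_perm_isomorphic_conj; apply conj_perm_isomorphic_refl. }
apply step; simpl in Hu, Hv.
destruct Hu as [<-|[<-|[<-|[]]]], Hv as [<-|[<-|[<-|[]]]]; rewrite ?E; auto.
Qed.

(** * The isomorphisms *)

Lemma inverse2_id : inverse2 id_mat id_mat.
Proof.
intros i k Hi Hk; below2 i; below2 k; unfold mul2, dot2, id_mat; simpl; split; ring.
Qed.

(** [S - Q P] (see [Pmat]). *)
Definition sigma_row (p : weights) : nat -> R :=
  vec3 (-2 * wt1 p * (1 + wt1 p)) (-2 * wt1 p * wt2 p) (-2 * wt2 p * (1 + wt2 p)).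

(** [S + Q P]. *)
Definition tau_row (p : weights) : nat -> R :=
  vec3 (2 * wt1 p ^ 2) (2 * wt1 p * wt2 p) (2 * wt2 p ^ 2).

Definition Psigma (p : weights) : nat -> nat -> R :=
  rows3 (Pmat p 0%nat) (Pmat p 1%nat) (sigma_row p).

(** For [delta p = 2] the last factor is [wtmu p - 1], so the determinant vanishes exactly under the
    alternatives defining the first class. *)
Lemma det3_Psigma p :
  det3 (Psigma p) = -2 * wt1 p * wt2 p * (1 + wt1 p + wt2 p).
Proof. unfold det3, Psigma, sigma_row, Pmat; simpl; ring. Qed.

(** Take [N = 0]. The second and third equations then give [K] and [L], and the fourth, where [L]
    has the factor [delta - 2 = 0], becomes the condition on [sigma_row]. *)
Lemma isomorphic_delta_2 M p q A A' B B' c :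
  delta p = 2 -> delta q = 2 -> inverse3 A A' -> inverse2 B B' -> c <> 0 ->
  (forall i k, (i < 2)%nat -> (k < 3)%nat ->
    dot2 (B i) (fun j => Pmat p j k) = dot3 (Pmat q i) (fun l => A l k)) ->
  (forall k, (k < 3)%nat -> c * sigma_row p k = dot3 (sigma_row q) (fun l => A l k)) ->
  isomorphic M p q.
Proof.
intros Hp Hq HA HB Hc HP Hs.
pose (K i := dot2 (Qrow q) (fun j => B j i) - c * Qrow p i).
apply (isomorphic_of_jet_iso _ _ _ (transform A B c (fun _ _ => 0) K
  (fun k => - dot2 K (fun j => Pmat p j k)))).
apply (transform_iso _ _ _ A' _ B'); auto; [congruence|].
unfold intertwining; rewrite Hp; repeat split.
- intros i k Hi Hk; rewrite <- HP by auto; ring.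
- intros i Hi; unfold K; ring.
- intros k Hk; unfold dot2; ring.
- intros k Hk; specialize (Hs k Hk).
  pose proof (HP 0%nat k ltac:(lia) Hk) as P0.
  pose proof (HP 1%nat k ltac:(lia) Hk) as P1.
  assert (Sq : dot3 (Srow q) (fun l => A l k) = dot3 (sigma_row q) (fun l => A l k)
     + Qrow q 0%nat * dot3 (Pmat q 0%nat) (fun l => A l k)
     + Qrow q 1%nat * dot3 (Pmat q 1%nat) (fun l => A l k)) by
    (unfold dot3, sigma_row, Srow, Qrow, Pmat; simpl; ring).
  assert (Sp : Srow p k = sigma_row p k + dot2 (Qrow p) (fun j => Pmat p j k)) by
    (below3 k; unfold dot2, sigma_row, Srow, Qrow, Pmat; simpl; ring).
  rewrite Sq, Sp, <- Hs, <- P0, <- P1; unfold K, dot2; ring.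
Qed.

(** On this class [Psigma] is invertible, so [A = (Psigma q)^-1 (Psigma p)] with [B = 1] and [c = 1]
    matches all three rows at once. *)
Lemma second_class_isomorphic M p q :
  second_class p -> second_class q -> isomorphic M p q.
Proof.
assert (HD : forall p, second_class p -> det3 (Psigma p) <> 0).
{ intros [l1 l2 mu] [[Hd _] [H1 [H2 H3]]]; unfold delta in *; simpl in *.
  rewrite det3_Psigma; simpl.
  repeat apply Rmult_integral_contrapositive_currified; lra. }
intros Hp Hq.
destruct (inverse3_exists _ (HD p Hp)) as [U' HU].
destruct (inverse3_exists _ (HD q Hq)) as [V' HV].
apply (isomorphic_delta_2 M p q (mul3 V' (Psigma p)) (mul3 U' (Psigma q))
  id_mat id_mat 1); auto using inverse2_id, inverse3_mul, inverse3_sym with real;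
  try apply Hp; try apply Hq.
- intros i k Hi Hk.
  transitivity (Psigma p i k);
    [below2 i; unfold dot2, id_mat, Psigma; simpl; ring|].
  rewrite <- (inverse3_solve (Psigma p) _ _ HV i k ltac:(lia)).
  below2 i; reflexivity.
- intros k Hk; rewrite Rmult_1_l; symmetry.
  exact (inverse3_solve (Psigma p) _ _ HV 2 k ltac:(lia)).
Qed.

(** For weights [(0, s)] the second row of [P] and [sigma_row] see only the last coordinate, with
    factors [-(1 + 2 s)] and [-2 s (1 + s)]. [B] and [c] rescale these, [A] shears the first row,
    and the excluded values are the zeros of the factors. *)
Lemma isomorphic_first_weight_zero M s t :
  s <> 0 -> s <> -1 -> s <> -1/2 -> t <> 0 -> t <> -1 -> t <> -1/2 ->
  isomorphic M (shifted 2 0 s) (shifted 2 0 t).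
Proof.
intros Hs0 Hs1 Hs2 Ht0 Ht1 Ht2.
pose (A := rows3 (vec3 1 (s - t) 0) (vec3 0 1 0) (vec3 0 0 1)).
pose (B := rows2 (vec2 1 0) (vec2 0 ((1 + 2 * t) / (1 + 2 * s)))).
destruct (inverse3_exists A) as [A' HA]; [unfold det3; simpl; lra|].
assert (Hs : 1 + 2 * s <> 0) by lra.
assert (Ht : 1 + 2 * t <> 0) by lra.
destruct (inverse2_exists B) as [B' HB].
{ simpl; intros E; apply Ht.
  apply (Rmult_eq_compat_r (1 + 2 * s)) in E; field_simplify in E; lra. }
assert (Hs3 : 1 + s <> 0) by lra.
apply (isomorphic_delta_2 M _ _ A A' B B' (t * (1 + t) / (s * (1 + s))) ); auto.
- unfold delta; simpl; ring.
- unfold delta; simpl; ring.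
- apply Rmult_integral_contrapositive_currified;
    [|apply Rinv_neq_0_compat];
    apply Rmult_integral_contrapositive_currified; lra.
- intros i k Hi Hk; below2 i; below3 k; unfold dot2, dot3, Pmat; simpl;
    field; auto.
- intros k Hk; below3 k; unfold dot3, sigma_row; simpl; field; auto.
Qed.

Ltac find_weights :=
  first [left; f_equal; lra | right; left; f_equal; lra
        |right; right; left; f_equal; lra].

(** A permutation or conjugation moves each alternative to first weight zero; [s = 0] and [s = -1]
    would fall in [list_2_0], and [s = -1/2] in [list_2_half]. *)
Lemma first_class_zero M p :
  first_class p -> exists s, s <> 0 /\ s <> -1 /\ s <> -1/2 /\
    isomorphic M p (shifted 2 0 s) /\ isomorphic M (shifted 2 0 s) p.
Proof.
destruct p as [l1 l2 mu]; intros [[Hd [H0 Hh]] Hz].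
unfold delta in Hd; simpl in *.
assert (Hmu : mu = 2 + (l1 + l2)) by lra; subst mu; clear Hd.
destruct Hz as [-> | [-> | H]].
- exists l2; repeat split;
    try (intros ->; first [apply H0; find_weights | apply Hh; find_weights]);
    unfold shifted; exists (fun A => A); apply is_isomorphism_id.
- exists l1; repeat split;
    try (intros ->; first [apply H0; find_weights | apply Hh; find_weights]).
  + replace (shifted 2 0 l1) with (wt_permute (Weights l1 0 (2 + (l1 + 0)))) by
      (unfold shifted, wt_permute; simpl; f_equal; ring).
    apply isomorphic_permute.
  + replace (Weights l1 0 (2 + (l1 + 0))) with (wt_permute (shifted 2 0 l1)) by
      (unfold shifted, wt_permute; simpl; f_equal; ring).
    apply isomorphic_permute.
- assert (l2 = -1 - l1) by lra; subst l2; exists l1; repeat split;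
    try (intros ->; first [apply H0; find_weights | apply Hh; find_weights]).
  + replace (Weights l1 (-1 - l1) (2 + (l1 + (-1 - l1)))) with (wt_conj (shifted 2 0 l1)) by
      (unfold shifted, wt_conj; simpl; f_equal; ring).
    apply isomorphic_conj_inv.
  + replace (Weights l1 (-1 - l1) (2 + (l1 + (-1 - l1)))) with (wt_conj (shifted 2 0 l1)) by
      (unfold shifted, wt_conj; simpl; f_equal; ring).
    apply isomorphic_conj.
Qed.

Lemma first_class_isomorphic M p q :
  first_class p -> first_class q -> isomorphic M p q.
Proof.
intros Hp Hq.
destruct (first_class_zero M p Hp) as [s [Hs0 [Hs1 [Hs2 [Hs _]]]]].
destruct (first_class_zero M q Hq) as [t [Ht0 [Ht1 [Ht2 [_ Ht]]]]].
eapply isomorphic_trans; [exact Hs|].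
eapply isomorphic_trans; [|exact Ht].
apply isomorphic_first_weight_zero; auto.
Qed.

(** Here [K] has the factor [delta - 1 = 0] in the second equation, which [B] must solve. With
    [K = 0] the first and third give [N] and [L], and the fourth becomes [c tau_p = tau_q A],
    solvable because both rows are nonzero. *)
Lemma isomorphic_delta_1 M l1 l2 r1 r2 :
  ~ (l1 = 0 /\ l2 = 0) -> ~ (r1 = 0 /\ r2 = 0) ->
  isomorphic M (shifted 1 l1 l2) (shifted 1 r1 r2).
Proof.
intros Hl Hr.
assert (pos : forall a b, ~ (a = 0 /\ b = 0) -> a ^ 2 + b ^ 2 <> 0) by
  (intros a b H E; apply H; nra).
pose (c := r1 ^ 2 + r2 ^ 2).
assert (Hc : c <> 0) by (apply pos; auto).
set (p := shifted 1 l1 l2); set (q := shifted 1 r1 r2).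
(* The transpose of [c] times complex multiplication by
   [(l1 + i l2) / (r1 + i r2)]. *)
pose (B := rows2 (vec2 (r1 * l1 + r2 * l2) (r1 * l2 - r2 * l1))
                 (vec2 (r2 * l1 - r1 * l2) (r1 * l1 + r2 * l2))).
destruct (inverse2_exists B) as [B' HB].
{ simpl; replace (_ - _) with (c * (l1 ^ 2 + l2 ^ 2)) by (unfold c; ring).
  apply Rmult_integral_contrapositive_currified; auto. }
assert (tau_nz : forall a b, ~ (a = 0 /\ b = 0) -> forall k, k <> 0 ->
  ~ (k * (2 * a ^ 2) = 0 /\ k * (2 * a * b) = 0 /\ k * (2 * b ^ 2) = 0)).
{ intros a b H k Hk [E1 [_ E2]]; apply (pos a b H).
  apply Rmult_integral in E1, E2; destruct E1, E2; lra. }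
destruct (exists_row_transport (fun k => c * tau_row p k) (tau_row q)) as [A [A' [HA HT]]].
{ apply (tau_nz l1 l2); auto. }
{ pose proof (tau_nz r1 r2 Hr 1 ltac:(lra)) as H; rewrite !Rmult_1_l in H; exact H. }
pose (N i k := dot2 (B i) (fun j => Pmat p j k) - dot3 (Pmat q i) (fun l => A l k)).
apply (isomorphic_of_jet_iso _ _ _ (transform A B c N (fun _ => 0)
  (fun k => - dot2 (Qrow q) (fun j => N j k)))).
apply (transform_iso _ _ _ A' _ B'); auto;
  [unfold delta, p, q; simpl; ring|].
assert (Hd : delta p = 1) by (unfold delta, p; simpl; ring).
assert (HQ : forall i, (i < 2)%nat -> c * Qrow p i = dot2 (Qrow q) (fun j => B j i)).
{ intros i Hi; below2 i; unfold dot2, c; simpl; ring. }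
unfold intertwining; rewrite Hd; repeat split.
- intros i k Hi Hk; unfold N; ring.
- intros i Hi; rewrite <- HQ by auto; ring.
- intros k Hk; unfold dot2; ring.
- intros k Hk; specialize (HT k Hk); cbv beta in HT.
  assert (Sq : dot3 (Srow q) (fun l => A l k) = dot3 (tau_row q) (fun l => A l k)
     - Qrow q 0%nat * dot3 (Pmat q 0%nat) (fun l => A l k)
     - Qrow q 1%nat * dot3 (Pmat q 1%nat) (fun l => A l k)) by
    (unfold dot3, tau_row, Srow, Qrow, Pmat; simpl; ring).
  assert (Sp : c * Srow p k = c * tau_row p k - (c * Qrow p 0%nat) * Pmat p 0%nat k
     - (c * Qrow p 1%nat) * Pmat p 1%nat k) by
    (below3 k; unfold tau_row, Srow, Qrow, Pmat; simpl; ring).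
  rewrite Sq, Sp, !HQ, HT by lia; unfold N, dot2; ring.
Qed.

(** [Q P]. *)
Definition QP_row (p : weights) : nat -> R :=
  vec3 (wt1 p * (1 + 2 * wt1 p)) (2 * wt1 p * wt2 p) (wt2 p * (1 + 2 * wt2 p)).

(** With [B = 1] and [c = 1], the first, second and fourth equations give [N], [K] and [L]; in the
    third, [L] has the factor [2 delta - 3 = 0], and what is left is the transport of [Q P] by
    [A]. *)
Lemma isomorphic_delta_3half M p q :
  delta p = 3/2 -> delta q = 3/2 ->
  ~ (QP_row p 0%nat = 0 /\ QP_row p 1%nat = 0 /\ QP_row p 2%nat = 0) ->
  ~ (QP_row q 0%nat = 0 /\ QP_row q 1%nat = 0 /\ QP_row q 2%nat = 0) ->
  isomorphic M p q.
Proof.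
intros Hdp Hdq Hp Hq.
destruct (exists_row_transport (QP_row p) (QP_row q) Hp Hq) as [A [A' [HA HT]]].
pose (N i k := 2 * (Pmat p i k - dot3 (Pmat q i) (fun l => A l k))).
pose (K i := 2 * (Qrow q i - Qrow p i)).
apply (isomorphic_of_jet_iso _ _ _ (transform A id_mat 1 N K
  (fun k => 2 * (Srow p k + dot2 K (fun j => Pmat p j k)
                 - dot3 (Srow q) (fun l => A l k))))).
apply (transform_iso _ _ _ A' _ id_mat); auto using inverse2_id with real;
  [congruence|].
unfold intertwining; rewrite Hdp; repeat split.
- intros i k Hi Hk; below2 i; unfold N, dot2, id_mat; simpl; field.
- intros i Hi; below2 i; unfold K, dot2, id_mat; simpl; field.
- intros k Hk; specialize (HT k Hk).
  assert (Eq : dot3 (QP_row q) (fun l => A l k) =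
     Qrow q 0%nat * dot3 (Pmat q 0%nat) (fun l => A l k)
     + Qrow q 1%nat * dot3 (Pmat q 1%nat) (fun l => A l k)) by
    (unfold dot3, QP_row, Qrow, Pmat; simpl; ring).
  assert (Ep : QP_row p k = dot2 (Qrow p) (fun j => Pmat p j k)) by
    (below3 k; unfold dot2, QP_row, Qrow, Pmat; simpl; ring).
  rewrite Eq, Ep in HT; unfold dot2 in *; unfold K, N; lra.
- intros k Hk; field.
Qed.

(** * Invariants of the modules *)

Section Invariants.

Context {M : manifold}.

Definition jet_const (a0 a1 a2 b0 b1 e : R) : jet M :=
  Jet (sf_const a0) (sf_const a1) (sf_const a2)
      (sf_const b0) (sf_const b1) (sf_const e).

Definition jet_zero : jet M := jet_const 0 0 0 0 0 0.

Definition constant (u : jet M) : Prop :=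
  exists a0 a1 a2 b0 b1 e, u = jet_const a0 a1 a2 b0 b1 e.

Definition cosine (n : nat) : smooth_fun M := sf_trig n 1 0.
Definition sine (n : nat) : smooth_fun M := sf_trig n 0 1.

(** Up to the action of [d/dx], the Casimir element of the copy of [sl_2]
    spanned by [1], [cos n x], [sin n x]. *)
Definition casimir (p : weights) (n : nat) (u : jet M) : jet M :=
  jet_plus (jet_lie p (cosine n) (jet_lie p (cosine n) u))
           (jet_lie p (sine n) (jet_lie p (sine n) u)).

(** [Q P - (2 delta - 3) S]. *)
Definition omega_row (p : weights) : nat -> R :=
  vec3 (2 * wt1 p * (wt1 p + delta p - 1)) (2 * wt1 p * wt2 p)
       (2 * wt2 p * (wt2 p + delta p - 1)).

Lemma jet_lie_one p (u : jet M) :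
  jet_lie p (sf_const 1) u =
  Jet (sf_derive (c20 u)) (sf_derive (c11 u)) (sf_derive (c02 u))
      (sf_derive (c10 u)) (sf_derive (c01 u)) (sf_derive (c00 u)).
Proof.
apply jet_ext; unfold jet_lie, jet_of_coefs, lie_coefs;
  cbn [c20 c11 c02 c10 c01 c00 coefs]; sf_pointwise; ring.
Qed.

Lemma constant_iff p (u : jet M) :
  constant u <-> jet_lie p (sf_const 1) u = jet_zero.
Proof.
rewrite jet_lie_one; split.
- intros [a0 [a1 [a2 [b0 [b1 [e ->]]]]]]; unfold jet_const;
    cbn [c20 c11 c02 c10 c01 c00]; rewrite !sf_derive_const; reflexivity.
- destruct u as [u20 u11 u02 u10 u01 u00]; cbn [c20 c11 c02 c10 c01 c00].
  intros E.
  pose proof (f_equal c20 E) as E1; pose proof (f_equal c11 E) as E2;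
  pose proof (f_equal c02 E) as E3; pose proof (f_equal c10 E) as E4;
  pose proof (f_equal c01 E) as E5; pose proof (f_equal c00 E) as E6.
  simpl c20 in E1; simpl c11 in E2; simpl c02 in E3; simpl c10 in E4;
    simpl c01 in E5; simpl c00 in E6.
  do 6 eexists; unfold jet_const; f_equal; apply sf_derive_zero_const; assumption.
Qed.

(** [t k l m] is [k X' + l X'' + m X'''] for the field [X = sf_trig n al be]. *)
Lemma jet_lie_trig_const p n al be a0 a1 a2 b0 b1 e :
  let d := delta p in
  let a := vec3 a0 a1 a2 in
  let N := INR n in
  let t k l m := sf_trig n (N * be * k - N ^ 2 * al * l - N ^ 3 * be * m)
                           (- N * al * k - N ^ 2 * be * l + N ^ 3 * al * m) in
  jet_lie p (sf_trig n al be) (jet_const a0 a1 a2 b0 b1 e) =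
  Jet (t ((d - 2) * a0) 0 0) (t ((d - 2) * a1) 0 0) (t ((d - 2) * a2) 0 0)
      (t ((d - 1) * b0) (dot3 (Pmat p 0%nat) a) 0)
      (t ((d - 1) * b1) (dot3 (Pmat p 1%nat) a) 0)
      (t (d * e) (dot2 (Qrow p) (vec2 b0 b1)) (dot3 (Srow p) a)).
Proof.
intros d a N t.
apply jet_ext; unfold jet_lie, jet_of_coefs, lie_coefs, jet_const, t, N, d, a,
    dot3, dot2, Pmat, Qrow, Srow;
  cbn [c20 c11 c02 c10 c01 c00 coefs rows2 vec3 vec2]; sf_pointwise;
  cbn [sf_val sf_trig]; ring.
Qed.

(** Products of derivatives of odd total order, such as [X' X''], cancel between cosine and sine;
    hence no entry from [a] to [b] or from [b] to [c]. *)
Lemma casimir_const p n a0 a1 a2 b0 b1 e :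
  let d := delta p in
  let x := INR n ^ 2 * ((d - 2) * (d - 3)) in
  let y := INR n ^ 2 * ((d - 1) * (d - 2)) in
  casimir p n (jet_const a0 a1 a2 b0 b1 e) =
  jet_const (x * a0) (x * a1) (x * a2) (y * b0) (y * b1)
    (INR n ^ 2 * (d * (d - 1)) * e + INR n ^ 4 * dot3 (omega_row p) (vec3 a0 a1 a2)).
Proof.
intros d x y.
unfold casimir, cosine, sine; rewrite !jet_lie_trig_const.
apply jet_ext; unfold jet_plus, jet_lie, jet_of_coefs, lie_coefs, jet_const,
    omega_row, x, y, d, dot3, dot2, Pmat, Qrow, Srow;
  cbn [c20 c11 c02 c10 c01 c00 coefs rows2 vec3 vec2]; sf_pointwise;
  cbn [sf_val sf_trig];
  pose proof (sin2_cos2 (INR n * x0)) as H; unfold Rsqr in H;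
  assert (E : sin (INR n * x0) * sin (INR n * x0)
              = 1 - cos (INR n * x0) * cos (INR n * x0)) by lra;
  generalize dependent (sin (INR n * x0));
  generalize dependent (cos (INR n * x0)); intros; unfold delta; ring [E].
Qed.

Lemma jet_const_eq a0 a1 a2 b0 b1 e a0' a1' a2' b0' b1' e' :
  jet_const a0 a1 a2 b0 b1 e = jet_const a0' a1' a2' b0' b1' e' ->
  a0 = a0' /\ a1 = a1' /\ a2 = a2' /\ b0 = b0' /\ b1 = b1' /\ e = e'.
Proof.
intros E; repeat split;
  [apply (f_equal (fun u => sf_val (c20 u) 0)) in E
  |apply (f_equal (fun u => sf_val (c11 u) 0)) in E
  |apply (f_equal (fun u => sf_val (c02 u) 0)) in E
  |apply (f_equal (fun u => sf_val (c10 u) 0)) in E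
  |apply (f_equal (fun u => sf_val (c01 u) 0)) in E
  |apply (f_equal (fun u => sf_val (c00 u) 0)) in E]; exact E.
Qed.

Lemma jet_const_plus a0 a1 a2 b0 b1 e a0' a1' a2' b0' b1' e' :
  jet_plus (jet_const a0 a1 a2 b0 b1 e) (jet_const a0' a1' a2' b0' b1' e') =
  jet_const (a0 + a0') (a1 + a1') (a2 + a2') (b0 + b0') (b1 + b1') (e + e').
Proof. apply jet_ext; apply sf_ext; reflexivity. Qed.

Lemma jet_const_scal s a0 a1 a2 b0 b1 e :
  jet_scal s (jet_const a0 a1 a2 b0 b1 e) =
  jet_const (s * a0) (s * a1) (s * a2) (s * b0) (s * b1) (s * e).
Proof. apply jet_ext; apply sf_ext; reflexivity. Qed.

Lemma jet_iso_sym p q (F : jet M -> jet M) :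
  jet_iso p q F -> exists G, jet_iso q p G /\
    (forall u, F (G u) = u) /\ (forall u, G (F u) = u).
Proof.
intros [Hp [Hs [Hi [Hr HL]]]].
pose (G v := proj1_sig (constructive_indefinite_description _ (Hr v))).
assert (FG : forall v, F (G v) = v) by
  (intros v; exact (proj2_sig (constructive_indefinite_description _ (Hr v)))).
assert (GF : forall v, G (F v) = v) by (intros v; apply Hi, FG).
exists G; repeat split; auto.
- intros u v; apply Hi; rewrite Hp, !FG; reflexivity.
- intros c u; apply Hi; rewrite Hs, !FG; reflexivity.
- intros u v E; rewrite <- (FG u), <- (FG v), E; reflexivity.
- intros v; exists (F v); apply GF.
- intros X u; apply Hi; rewrite HL, !FG; reflexivity.
Qed.

Lemma jet_scal_0 (u : jet M) : jet_scal 0 u = jet_zero.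
Proof. apply jet_ext; apply sf_ext; intros x; simpl; ring. Qed.

Lemma jet_iso_zero p q (F : jet M -> jet M) : jet_iso p q F -> F jet_zero = jet_zero.
Proof.
intros [_ [Hs _]]; transitivity (F (jet_scal 0 jet_zero)).
- rewrite jet_scal_0; reflexivity.
- rewrite Hs; apply jet_scal_0.
Qed.

Lemma jet_iso_constant p q (F : jet M -> jet M) u : jet_iso p q F -> constant u -> constant (F u).
Proof.
intros HF Hu; apply (constant_iff q).
assert (H0 := jet_iso_zero p q F HF); destruct HF as [_ [_ [_ [_ HL]]]].
rewrite <- HL, (proj1 (constant_iff p u) Hu); exact H0.
Qed.

Lemma jet_iso_casimir p q (F : jet M -> jet M) n u :
  jet_iso p q F -> F (casimir p n u) = casimir q n (F u).
Proof. intros [Hp [_ [_ [_ HL]]]]; unfold casimir; rewrite Hp, !HL; reflexivity. Qed.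

End Invariants.

(** * What an isomorphism preserves *)

Ltac const_jets :=
  rewrite ?casimir_const, ?jet_const_scal, ?jet_const_plus in *;
  rewrite ?casimir_const, ?jet_const_scal, ?jet_const_plus in *.

Section Transport.

Context {M : manifold}.

(** An isomorphism carries constants to constants and commutes with the Casimir, so the quadratic
    relation passes to [q], where every diagonal entry must be a root. *)
Lemma casimir_polynomial p q (F : jet M -> jet M) s t :
  jet_iso p q F ->
  (forall u : jet M, constant u -> casimir p 1 (casimir p 1 u) =
    jet_plus (jet_scal s (casimir p 1 u)) (jet_scal t u)) ->
  forall x, x = (delta q - 2) * (delta q - 3) \/
            x = (delta q - 1) * (delta q - 2) \/ x = delta q * (delta q - 1) ->
  x ^ 2 = s * x + t.
Proof.
intros HF Hpoly.
destruct (jet_iso_sym _ _ _ HF) as [G [HG [FG GF]]].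
assert (H : forall u : jet M, constant u -> casimir q 1 (casimir q 1 u) =
    jet_plus (jet_scal s (casimir q 1 u)) (jet_scal t u)).
{ intros u Hu; specialize (Hpoly (G u) (jet_iso_constant _ _ _ _ HG Hu)).
  apply (f_equal F) in Hpoly.
  pose proof (fun n u => jet_iso_casimir p q F n u HF) as HC.
  destruct HF as [Hp [Hs _]]; rewrite Hp, !Hs, !HC, FG in Hpoly; exact Hpoly. }
clear - H.
assert (HC : forall a b e, casimir q 1 (casimir q 1 (jet_const (M := M) a 0 0 b 0 e)) =
  jet_plus (jet_scal s (casimir q 1 (jet_const a 0 0 b 0 e)))
           (jet_scal t (jet_const a 0 0 b 0 e))) by
  (intros; apply H; repeat eexists).
intros x [-> | [-> | ->]].
- specialize (HC 1 0 0); const_jets; apply jet_const_eq in HC; simpl INR in HC.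
  lra.
- specialize (HC 0 1 0); const_jets; apply jet_const_eq in HC; simpl INR in HC.
  lra.
- specialize (HC 0 0 1); const_jets; apply jet_const_eq in HC; simpl INR in HC.
  unfold dot3, omega_row in HC; simpl in HC; lra.
Qed.

(** Vanishing of the [n^4] term means that on constants the Casimir for [n = 2] is 4 times that for
    [n = 1], a relation visible to any isomorphism. *)
Lemma omega_transport p q (F : jet M -> jet M) :
  jet_iso p q F -> (forall k, (k < 3)%nat -> omega_row p k = 0) ->
  forall k, (k < 3)%nat -> omega_row q k = 0.
Proof.
intros HF Hom.
destruct (jet_iso_sym _ _ _ HF) as [G [HG [FG GF]]].
assert (H : forall u : jet M, constant u -> casimir q 2 u = jet_scal 4 (casimir q 1 u)).
{ intros u Hu.
  destruct (jet_iso_constant _ _ _ _ HG Hu) as [a0 [a1 [a2 [b0 [b1 [e E]]]]]].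
  rewrite <- (FG u), <- !(jet_iso_casimir p q F _ _ HF).
  rewrite <- (proj1 (proj2 HF)); f_equal; rewrite E; const_jets.
  unfold dot3; rewrite !Hom by lia; f_equal; simpl; ring. }
intros k Hk.
pose proof (H (jet_const (id_mat k 0) (id_mat k 1) (id_mat k 2) 0 0 0)
  ltac:(repeat eexists)) as E.
const_jets; apply jet_const_eq in E; destruct E as [_ [_ [_ [_ [_ E]]]]].
unfold dot3 in E; below3 k; unfold id_mat in E; simpl in *; lra.
Qed.

(** For [delta p = 2] the Casimir [C] at [n = 1] maps the constants into a line, and [C^2 = 2 C].
    The first fact kills the scalar [(delta q - 2) (delta q - 3)], which acts on three coordinates;
    the second excludes [delta q = 3], where 6 would be an eigenvalue. *)
Lemma delta_2_transport p q (F : jet M -> jet M) :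
  jet_iso p q F -> delta p = 2 -> delta q = 2.
Proof.
intros HF Hd.
destruct (jet_iso_sym _ _ _ HF) as [G [HG [FG GF]]].
assert (Hz : (delta q * (delta q - 1)) ^ 2 = 2 * (delta q * (delta q - 1)) + 0).
{ apply (casimir_polynomial p q F 2 0 HF); [|auto].
  intros u [a0 [a1 [a2 [b0 [b1 [e ->]]]]]]; const_jets; rewrite Hd.
  f_equal; unfold dot3; simpl; ring. }
assert (line : forall a0 a1, exists r,
  casimir q 1 (jet_const a0 a1 0 0 0 0) = F (jet_const 0 0 0 0 0 r)).
{ intros a0 a1.
  destruct (jet_iso_constant _ _ _ (jet_const a0 a1 0 0 0 0) HG ltac:(repeat eexists))
    as [c0 [c1 [c2 [b0 [b1 [e E]]]]]].
  eexists; rewrite <- (FG (jet_const a0 a1 0 0 0 0)), <- (jet_iso_casimir p q F _ _ HF),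
    E, casimir_const, Hd.
  f_equal; f_equal; ring. }
assert (Hx : (delta q - 2) * (delta q - 3) = 0).
{ destruct (line 1 0) as [r Er], (line 0 1) as [s Es].
  assert (E : jet_scal s (casimir q 1 (jet_const (M := M) 1 0 0 0 0 0)) =
              jet_scal r (casimir q 1 (jet_const 0 1 0 0 0 0))).
  { rewrite Er, Es, <- !(proj1 (proj2 HF)), !jet_const_scal; f_equal; f_equal; ring. }
  const_jets; apply jet_const_eq in E; destruct E as [_ [E _]]; simpl INR in E.
  destruct (Req_dec ((delta q - 2) * (delta q - 3)) 0) as [|Hx]; [assumption|].
  assert (r = 0) as -> by (apply (Rmult_eq_reg_r ((delta q - 2) * (delta q - 3))); lra).
  rewrite (jet_iso_zero p q F HF : F (jet_const 0 0 0 0 0 0) = _) in Er.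
  unfold jet_zero in Er; apply jet_const_eq in Er; destruct Er as [Er _].
  simpl INR in Er; lra. }
apply Rmult_integral in Hx; destruct Hx as [Hx|Hx]; [lra|].
assert (delta q = 3) as E by lra; rewrite E in Hz; lra.
Qed.

Lemma invariant_constant q a0 a1 a2 b0 b1 e :
  delta q = 2 ->
  (forall n, jet_lie q (cosine n) (jet_const (M := M) a0 a1 a2 b0 b1 e) = jet_zero) ->
  b0 = 0 /\ b1 = 0 /\ e = 0 /\
  forall i, (i < 3)%nat -> dot3 (Psigma q i) (vec3 a0 a1 a2) = 0.
Proof.
intros Hd H.
assert (E : forall n x, let u := jet_lie q (cosine n) (jet_const (M := M) a0 a1 a2 b0 b1 e) in
  c10 u x = 0 /\ c01 u x = 0 /\ c00 u x = 0).
{ intros n x; cbv zeta; rewrite (H n); repeat split. }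
clear H.
(* At 0 only [X''] survives. At the other two points [X'' = 0] and [(X', X''')] is [(-1, 1)] and
   [(-2, 8)]; independence of these separates [e] from [S a]. *)
assert (E0 := E 1%nat 0); assert (E1 := E 1%nat (PI / 2));
  assert (E2 := E 2%nat (PI / 4)); clear E.
cbv zeta in *; unfold cosine in *; rewrite !jet_lie_trig_const, !Hd in *;
  cbn [c10 c01 c00 sf_val sf_trig] in *.
replace (INR 2 * (PI / 4)) with (PI / 2) in E2 by (simpl; field).
replace (INR 1 * (PI / 2)) with (PI / 2) in E1 by (simpl; field).
replace (INR 1 * 0) with 0 in E0 by ring.
rewrite cos_PI2, sin_PI2 in *; rewrite cos_0, sin_0 in E0; simpl INR in *.
destruct E0 as [E00 [E01 E02]], E1 as [E10 [E11 E12]], E2 as [E20 [E21 E22]].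
assert (b0 = 0) by lra; assert (b1 = 0) by lra; assert (e = 0) by lra; subst.
assert (HS : dot3 (Srow q) (vec3 a0 a1 a2) = 0) by lra.
assert (HP0 : dot3 (Pmat q 0%nat) (vec3 a0 a1 a2) = 0) by lra.
assert (HP1 : dot3 (Pmat q 1%nat) (vec3 a0 a1 a2) = 0) by lra.
repeat split; auto.
intros i Hi; below3 i; [exact HP0|exact HP1|].
transitivity (dot3 (Srow q) (vec3 a0 a1 a2)
  - Qrow q 0%nat * dot3 (Pmat q 0%nat) (vec3 a0 a1 a2)
  - Qrow q 1%nat * dot3 (Pmat q 1%nat) (vec3 a0 a1 a2)).
- unfold dot3, Psigma, sigma_row, Srow, Qrow, Pmat; simpl; ring.
- rewrite HS, HP0, HP1; ring.
Qed.

(** The operator [s f'' g - f' g'], the first transvectant of [f'] and [g], is invariant; its image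
    is a nonzero invariant constant, hence a kernel vector of [Psigma q]. *)
Lemma first_weight_zero_degenerate s q (F : jet M -> jet M) :
  jet_iso (shifted 2 0 s) q F -> delta q = 2 /\ det3 (Psigma q) = 0.
Proof.
intros HF.
assert (Hd : delta (shifted 2 0 s) = 2) by (unfold delta; simpl; ring).
assert (Hq := delta_2_transport _ _ _ HF Hd).
split; [exact Hq|].
pose (v := jet_const (M := M) s (-1) 0 0 0 0).
destruct (jet_iso_constant _ _ _ v HF ltac:(repeat eexists))
  as [a0 [a1 [a2 [b0 [b1 [e E]]]]]].
destruct (invariant_constant q a0 a1 a2 b0 b1 e Hq) as [-> [-> [-> H]]].
{ intros n; rewrite <- E.
  destruct HF as [Hp [Hs [Hi [Hr HL]]]]; rewrite <- HL.
  rewrite <- (jet_iso_zero _ _ F (conj Hp (conj Hs (conj Hi (conj Hr HL))))).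
  f_equal; unfold v, cosine; rewrite jet_lie_trig_const, Hd.
  apply jet_ext; unfold dot3, dot2, Pmat, Qrow, Srow, jet_zero, jet_const;
    cbn [c20 c11 c02 c10 c01 c00 vec2 vec3 rows2]; apply sf_ext; intros x;
    cbn [sf_val sf_trig sf_const wt1 wt2 shifted]; ring. }
destruct (Req_dec (det3 (Psigma q)) 0) as [|HD]; [assumption|exfalso].
destruct (inverse3_exists _ HD) as [U HU].
assert (Z : forall i, (i < 3)%nat -> vec3 a0 a1 a2 i = 0).
{ intros i Hi.
  pose proof (inverse3_solve (fun k _ => vec3 a0 a1 a2 k) _ _
    (inverse3_sym _ _ HU) i 0%nat Hi) as Ei; cbv beta in Ei.
  rewrite <- Ei; unfold mul3 at 1; unfold dot3.
  unfold mul3; rewrite !H by lia; ring. }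
pose proof (Z 0%nat ltac:(lia)); pose proof (Z 1%nat ltac:(lia));
  pose proof (Z 2%nat ltac:(lia)); simpl in *; subst.
rewrite <- (jet_iso_zero _ _ F HF : _ = jet_const 0 0 0 0 0 0) in E.
destruct HF as [_ [_ [Hi _]]]; apply Hi in E; unfold v, jet_zero in E.
apply jet_const_eq in E; lra.
Qed.

(** With the square of [d/dx] subtracted, the Casimir of [sl_2] is a scalar on all densities of
    weight [l], not only on constant ones. *)
Lemma density_casimir l (f : smooth_fun M) :
  sf_plus
    (sf_plus (lie_density l (cosine 1) (lie_density l (cosine 1) f))
             (lie_density l (sine 1) (lie_density l (sine 1) f)))
    (sf_scal (-1) (lie_density l (sf_const 1) (lie_density l (sf_const 1) f))) =
  sf_scal (l * (l - 1)) f.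
Proof.
unfold cosine, sine; sf_pointwise; cbn [sf_val sf_trig INR].
pose proof (sin2_cos2 (1 * x)) as H; unfold Rsqr in H.
assert (E : sin (1 * x) * sin (1 * x) = 1 - cos (1 * x) * cos (1 * x)) by lra.
generalize dependent (sin (1 * x)); generalize dependent (cos (1 * x)).
intros; ring [E].
Qed.

Lemma jet_lie_lower p X (f g h : smooth_fun M) :
  exists h', jet_lie p X (Jet (sf_const 0) (sf_const 0) (sf_const 0) f g h) =
    Jet (sf_const 0) (sf_const 0) (sf_const 0)
        (lie_density (delta p - 1) X f) (lie_density (delta p - 1) X g) h'.
Proof.
eexists; apply jet_ext; unfold jet_lie, jet_of_coefs, lie_coefs;
  cbn [c20 c11 c02 c10 c01 c00 coefs]; [..|reflexivity]; sf_pointwise; ring.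
Qed.

Lemma jet_lie_bottom p X (f : smooth_fun M) :
  let z := sf_const 0 in
  jet_lie p X (Jet z z z z z f) = Jet z z z z z (lie_density (delta p) X f).
Proof.
apply jet_ext; unfold jet_lie, jet_of_coefs, lie_coefs;
  cbn [c20 c11 c02 c10 c01 c00 coefs]; sf_pointwise; ring.
Qed.

(** For weights [(0, -1/2)] the vector [v] is killed by [P] but not by [S], so [L_X v] has order
    zero: a density of weight 2, where the Casimir is 2. In [q] the order-one part of the image has
    weight 1 and Casimir 0, so the same eigenvalue equation makes it vanish. *)
Lemma half_weight_kernel q (F : jet M -> jet M) :
  jet_iso (shifted 2 0 (-1/2)) q F ->
  exists a, dot3 (Pmat q 0%nat) a = 0 /\ dot3 (Pmat q 1%nat) a = 0 /\
    dot3 (sigma_row q) a <> 0.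
Proof.
intros HF; set (p := shifted 2 0 (-1/2)) in *.
assert (Hd : delta p = 2) by (unfold delta; simpl; field).
assert (Hq := delta_2_transport _ _ _ HF Hd).
pose (v := jet_const (M := M) 0 0 1 0 0 0).
destruct (jet_iso_constant _ _ _ v HF ltac:(repeat eexists))
  as [a0 [a1 [a2 [b0 [b1 [e E]]]]]].
pose (Om r (u : jet M) := jet_plus (casimir r 1 u)
  (jet_scal (-1) (jet_lie r (sf_const 1) (jet_lie r (sf_const 1) u)))).
assert (HOm : Om p (jet_lie p (cosine 1) v) = jet_scal 2 (jet_lie p (cosine 1) v)).
{ replace (jet_lie p (cosine 1) v) with
    (Jet (sf_const 0) (sf_const 0) (sf_const 0) (sf_const 0) (sf_const 0)
       (sf_trig (M := M) 1 0 (1/2))).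
  - unfold Om, casimir; rewrite !jet_lie_bottom, Hd.
    unfold jet_plus, jet_scal; cbn [c20 c11 c02 c10 c01 c00].
    rewrite density_casimir; f_equal; apply sf_ext; intros x; simpl; ring.
  - unfold v, cosine; rewrite jet_lie_trig_const, Hd.
    apply jet_ext; unfold dot3, dot2, Pmat, Qrow, Srow;
      cbn [c20 c11 c02 c10 c01 c00 vec2 vec3 rows2]; apply sf_ext; intros x;
      cbn [sf_val sf_trig sf_const wt1 wt2 shifted p INR]; field. }
assert (HOmq : Om q (jet_lie q (cosine 1) (F v)) = jet_scal 2 (jet_lie q (cosine 1) (F v))).
{ pose proof (fun n u => jet_iso_casimir p q F n u HF) as HC.
  destruct HF as [Hp [Hs [_ [_ HL]]]].
  apply (f_equal F) in HOm; unfold Om in *.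
  rewrite Hp, !Hs, HC, !HL in HOm; exact HOm. }
exists (vec3 a0 a1 a2).
assert (lower : exists f g h, jet_lie q (cosine 1) (F v) =
  Jet (sf_const 0) (sf_const 0) (sf_const 0) f g h).
{ do 3 eexists; rewrite E; unfold cosine; rewrite jet_lie_trig_const, Hq.
  f_equal; apply sf_ext; intros x; simpl; ring. }
destruct lower as [f [g [h Efgh]]].
assert (Hb : c10 (jet_lie q (cosine 1) (F v)) 0 = 0 /\
             c01 (jet_lie q (cosine 1) (F v)) 0 = 0).
{ rewrite Efgh in *; unfold Om, casimir in HOmq.
  destruct (jet_lie_lower q (cosine 1) f g h) as [h1 E1]; rewrite E1 in HOmq.
  destruct (jet_lie_lower q (sine 1) f g h) as [h2 E2]; rewrite E2 in HOmq.
  destruct (jet_lie_lower q (sf_const 1) f g h) as [h3 E3]; rewrite E3 in HOmq.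
  clear E1 E2 E3.
  repeat match type of HOmq with context [jet_lie q ?X (Jet _ _ _ ?f ?g ?h)] =>
    let k := fresh "k" in let Ek := fresh "Ek" in
    destruct (jet_lie_lower q X f g h) as [k Ek]; rewrite Ek in HOmq; clear Ek end.
  unfold jet_plus, jet_scal in HOmq; cbn [c20 c11 c02 c10 c01 c00] in HOmq.
  rewrite !density_casimir in HOmq.
  pose proof (f_equal (fun u => c10 u 0) HOmq) as H10.
  pose proof (f_equal (fun u => c01 u 0) HOmq) as H01.
  rewrite Hq in H10, H01; cbn [c10 c01 sf_val sf_scal] in H10, H01 |- *; split; lra. }
(* At 0 the field [cos x] has [X' = 0] and [X'' = -1], so the order-one coefficients there are those
   of [- P a]. *)
rewrite E in Hb; unfold cosine in Hb; rewrite jet_lie_trig_const, Hq in Hb.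
cbn [c10 c01 sf_val sf_trig] in Hb.
rewrite Rmult_0_r, cos_0, sin_0 in Hb; simpl INR in Hb.
split; [lra|split; [lra|intros Hsig]].
(* For [delta q = 2], [omega_row q] is [- sigma_row q]. If it killed [a], the [n^4] term would
   vanish on [F v] and hence on [v], but the last entry of [omega_row p] is [-1/2]. *)
assert (HC : casimir q 2 (F v) = jet_scal 4 (casimir q 1 (F v))).
{ rewrite E; const_jets; rewrite Hq.
  replace (omega_row q) with (fun k => - sigma_row q k)
    by (apply functional_extensionality; intros [|[|k]];
        unfold omega_row, sigma_row; simpl; rewrite ?Hq; ring).
  unfold dot3 in *.
  f_equal; simpl INR; lra. }
rewrite <- !(jet_iso_casimir p q F _ _ HF), <- (proj1 (proj2 HF)) in HC.
apply HF in HC; unfold v in HC; const_jets.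
apply jet_const_eq in HC; destruct HC as [_ [_ [_ [_ [_ HC]]]]].
unfold dot3, omega_row in HC; rewrite Hd in HC; simpl in HC; lra.
Qed.

End Transport.
(** * The classification *)

Lemma first_not_second M p q :
  first_class p -> second_class q -> ~ isomorphic M p q.
Proof.
intros Hp [[Hq _] [H1 [H2 H3]]] H.
destruct (first_class_zero M p Hp) as [s [_ [_ [_ [_ Hs]]]]].
destruct (jet_iso_of_isomorphic _ _ (isomorphic_trans _ _ _ _ Hs H)) as [F HF].
destruct (first_weight_zero_degenerate _ _ _ HF) as [_ HD].
rewrite det3_Psigma in HD; unfold delta in Hq.
revert HD; repeat apply Rmult_integral_contrapositive_currified; lra.
Qed.

Lemma list_2_0_orbit M p q :
  In p list_2_0 -> In q list_2_0 -> conj_perm_isomorphic M p q.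
Proof.
intros Hp Hq.
apply (conj_orbit_isomorphic M (Weights (-1) 0 1) (Weights 0 0 2) (Weights 0 (-1) 1));
  try (unfold wt_conj; simpl; f_equal; lra); simpl in *; tauto.
Qed.

Lemma list_2_half_orbit M p q :
  In p list_2_half -> In q list_2_half -> conj_perm_isomorphic M p q.
Proof.
intros Hp Hq.
apply (conj_orbit_isomorphic M (Weights (-1/2) 0 (3/2)) (Weights 0 (-1/2) (3/2))
  (Weights (-1/2) (-1/2) 1));
  try (unfold wt_conj; simpl; f_equal; lra); simpl in *; tauto.
Qed.

Lemma list_3half_orbit M p q :
  In p list_3half -> In q list_3half -> conj_perm_isomorphic M p q.
Proof.
intros Hp Hq.
apply (conj_orbit_isomorphic M (Weights (-1/2) 0 1) (Weights 0 0 (3/2))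
  (Weights 0 (-1/2) 1));
  try (unfold wt_conj; simpl; f_equal; lra); simpl in *; tauto.
Qed.

Lemma conj_perm_isomorphic_isomorphic M p q :
  conj_perm_isomorphic M p q -> isomorphic M p q.
Proof. intros [T [_ HT]]; exists T; exact HT. Qed.

(** For [delta = 2] the row [omega_row] vanishes at exactly the three listed weights. *)
Lemma exceptional_2_0 M : exceptional M list_2_0.
Proof.
split; [apply list_2_0_orbit|].
intros p q Hp Hq H; apply Hq.
assert (H0 : isomorphic M (Weights 0 0 2) q).
{ eapply isomorphic_trans; [|exact H].
  apply conj_perm_isomorphic_isomorphic, list_2_0_orbit; simpl; auto. }
destruct (jet_iso_of_isomorphic _ _ H0) as [F HF].
assert (Hd := delta_2_transport _ _ F HF ltac:(unfold delta; simpl; ring)).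
assert (Hom := omega_transport _ _ F HF
  ltac:(intros k Hk; below3 k; unfold omega_row; simpl; ring)).
pose proof (Hom 0%nat ltac:(lia)) as O0; pose proof (Hom 1%nat ltac:(lia)) as O1;
  pose proof (Hom 2%nat ltac:(lia)) as O2.
unfold omega_row in *; simpl in O0, O1, O2; rewrite Hd in *.
destruct q as [l1 l2 mu]; unfold delta in Hd; simpl in *.
apply Rmult_integral in O0, O1, O2.
destruct O0 as [O0|O0], O1 as [O1|O1], O2 as [O2|O2];
  first [exfalso; lra | find_weights].
Qed.

Lemma exceptional_2_half M : exceptional M list_2_half.
Proof.
split; [apply list_2_half_orbit|].
intros p q Hp Hq H; apply Hq.
assert (H0 : isomorphic M (shifted 2 0 (-1/2)) q).
{ eapply isomorphic_trans; [|exact H].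
  apply conj_perm_isomorphic_isomorphic, list_2_half_orbit; [|exact Hp].
  right; left; unfold shifted; f_equal; lra. }
destruct (jet_iso_of_isomorphic _ _ H0) as [F HF].
destruct (first_weight_zero_degenerate _ _ F HF) as [Hd HD].
destruct (half_weight_kernel _ F HF) as [a [P0 [P1 Hs]]].
rewrite det3_Psigma in HD.
destruct q as [l1 l2 mu]; unfold delta in Hd; simpl in Hd, HD.
unfold dot3, Pmat, sigma_row in *; simpl in *.
set (x := a 0%nat) in *; set (y := a 1%nat) in *; set (z := a 2%nat) in *.
apply Rmult_integral in HD; destruct HD as [HD|HD];
  [apply Rmult_integral in HD; destruct HD as [HD|HD]|].
- assert (l1 = 0) by lra; subst l1.
  destruct (Req_dec l2 (-1/2)) as [->|Hl]; [find_weights|exfalso; apply Hs].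
  assert (z = 0) as -> by (apply (Rmult_eq_reg_l (1 + 2 * l2)); lra); ring.
- subst l2.
  destruct (Req_dec l1 (-1/2)) as [->|Hl]; [find_weights|exfalso; apply Hs].
  assert (x = 0) as -> by (apply (Rmult_eq_reg_l (1 + 2 * l1)); lra); ring.
- assert (l2 = -1 - l1) by lra; subst l2.
  destruct (Req_dec l1 (-1/2)) as [->|Hl]; [find_weights|exfalso; apply Hs].
  apply (Rmult_eq_reg_l (1 + 2 * l1)); [|lra].
  (* On this family [(1 + 2 l1) sigma_row] is [2 l1 (1 + l1)] times the difference of the rows of
     [P]. *)
  transitivity (2 * l1 * (1 + l1) * ((- (1 + 2 * l1) * x + - (-1 - l1) * y + 0 * z)
    - (0 * x + - l1 * y + - (1 + 2 * (-1 - l1)) * z))); [ring|].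
  rewrite P0, P1; ring.
Qed.

(** The Casimir entries are 2, 0, 0, roots of [x^2 = 2 x], which leaves [delta q] equal to 1 or 2; 2
    is excluded by the inverse isomorphism. Then [omega_row q = 0] forces both weights to vanish. *)
Lemma singular_0_0_1 M : singular M (Weights 0 0 1).
Proof.
intros q H; destruct (jet_iso_of_isomorphic _ _ H) as [F HF].
assert (Hp : delta (Weights 0 0 1) = 1) by (unfold delta; simpl; ring).
assert (Hom0 : forall k, (k < 3)%nat -> omega_row (Weights 0 0 1) k = 0) by
  (intros k Hk; below3 k; unfold omega_row; simpl; ring).
assert (Hd2 : delta q <> 2).
{ intros E; destruct (jet_iso_sym _ _ _ HF) as [G [HG _]].
  assert (D := delta_2_transport _ _ G HG E); lra. }
assert (Hpol := casimir_polynomial _ _ F 2 0 HF).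
assert (Hd : delta q = 1).
{ assert (Hx := fun x => Hpol
    ltac:(intros u [a0 [a1 [a2 [b0 [b1 [e ->]]]]]]; const_jets; rewrite Hp;
          unfold dot3; rewrite !Hom0 by lia; f_equal; simpl; ring) x).
  assert (X := Hx _ (or_introl eq_refl)).
  assert (Z := Hx _ (or_intror (or_intror eq_refl))).
  set (d := delta q) in *.
  assert (X' : (d - 2) * (d - 3) * ((d - 1) * (d - 4)) = 0) by lra.
  assert (Z' : d * (d - 1) * ((d - 2) * (d + 1)) = 0) by lra.
  apply Rmult_integral in X', Z'.
  destruct X' as [X'|X'], Z' as [Z'|Z']; apply Rmult_integral in X', Z';
    destruct X' as [X'|X'], Z' as [Z'|Z']; lra. }
assert (Hom := omega_transport _ _ F HF Hom0).
pose proof (Hom 0%nat ltac:(lia)) as O0; pose proof (Hom 2%nat ltac:(lia)) as O2.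
unfold omega_row in *; simpl in O0, O2; rewrite Hd in *.
destruct q as [l1 l2 mu]; unfold delta in Hd; simpl in *.
apply Rmult_integral in O0, O2.
assert (l1 = 0) by (destruct O0; lra); assert (l2 = 0) by (destruct O2; lra).
subst; replace mu with 1 by lra; exists (fun A => A); constructor.
Qed.

Lemma singular_3half M p : In p list_3half -> singular M p.
Proof.
intros Hp q H; destruct (jet_iso_of_isomorphic _ _ H) as [F HF].
assert (Hdp : delta p = 3/2) by
  (destruct Hp as [<-|[<-|[<-|[]]]]; unfold delta; simpl; field).
assert (Hom0 : forall k, (k < 3)%nat -> omega_row p k = 0).
{ intros k Hk; unfold omega_row; rewrite Hdp.
  destruct Hp as [<-|[<-|[<-|[]]]]; below3 k; simpl; field. }
(* For [delta = 3/2] the Casimir entries are 3/4, -1/4, 3/4, the roots of [x^2 = x/2 + 3/16]. *)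
assert (Hpol := casimir_polynomial _ _ F (1/2) (3/16) HF).
assert (Hd : delta q = 3/2).
{ assert (Hx := fun x => Hpol
    ltac:(intros u [a0 [a1 [a2 [b0 [b1 [e ->]]]]]]; const_jets; rewrite Hdp;
          unfold dot3; rewrite !Hom0 by lia; f_equal; simpl; field) x).
  assert (X := Hx _ (or_introl eq_refl)).
  assert (Z := Hx _ (or_intror (or_intror eq_refl))).
  set (d := delta q) in *.
  assert (X' : (d - 3/2) * (d - 7/2) * ((d - 5/2) * (d - 5/2)) = 0) by lra.
  assert (Z' : (d - 3/2) * (d + 1/2) * ((d - 1/2) * (d - 1/2)) = 0) by lra.
  apply Rmult_integral in X', Z'.
  destruct X' as [X'|X'], Z' as [Z'|Z']; apply Rmult_integral in X', Z';
    destruct X' as [X'|X'], Z' as [Z'|Z']; lra. }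
assert (Hom := omega_transport _ _ F HF Hom0).
pose proof (Hom 0%nat ltac:(lia)) as O0; pose proof (Hom 1%nat ltac:(lia)) as O1;
  pose proof (Hom 2%nat ltac:(lia)) as O2.
unfold omega_row in *; simpl in O0, O1, O2; rewrite Hd in *.
assert (Hq : In q list_3half).
{ destruct q as [l1 l2 mu]; unfold delta in Hd; simpl in *.
  apply Rmult_integral in O0, O1, O2.
  destruct O0 as [O0|O0], O1 as [O1|O1], O2 as [O2|O2];
    first [exfalso; lra | find_weights]. }
destruct (list_3half_orbit M p q Hp Hq) as [T [HT _]]; exists T; exact HT.
Qed.

Lemma shifted_3half_generic l1 l2 :
  let p := shifted (3/2) l1 l2 in
  ~ In p list_3half -> ~ (QP_row p 0%nat = 0 /\ QP_row p 1%nat = 0 /\ QP_row p 2%nat = 0).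
Proof.
simpl; intros Hp [O0 [O1 O2]]; apply Hp; unfold shifted.
apply Rmult_integral in O0, O1, O2.
destruct O0 as [O0|O0], O1 as [O1|O1], O2 as [O2|O2];
  first [exfalso; lra | find_weights].
Qed.

Theorem theorem10p5 : forall M : manifold,
  ((forall s : R, isomorphic M (shifted 2 0 s) (shifted 2 s 0)) /\
   (forall p q, first_class p -> first_class q -> isomorphic M p q) /\
   (forall p q, second_class p -> second_class q -> isomorphic M p q) /\
   (forall p q, first_class p -> second_class q -> ~ isomorphic M p q) /\
   exceptional M list_2_0 /\
   exceptional M list_2_half) /\
  ((forall l1 l2 r1 r2 : R,
      shifted 1 l1 l2 <> Weights 0 0 1 -> shifted 1 r1 r2 <> Weights 0 0 1 ->
      isomorphic M (shifted 1 l1 l2) (shifted 1 r1 r2)) /\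
   singular M (Weights 0 0 1)) /\
  ((forall l1 l2 r1 r2 : R,
      ~ In (shifted (3/2) l1 l2) list_3half ->
      ~ In (shifted (3/2) r1 r2) list_3half ->
      isomorphic M (shifted (3/2) l1 l2) (shifted (3/2) r1 r2)) /\
   (forall p q, In p list_3half -> In q list_3half ->
      conj_perm_isomorphic M p q) /\
   (forall p, In p list_3half -> singular M p)).
Proof.
intros M; split; [|split].
- split; [|split; [|split; [|split; [|split]]]].
  + intros s.
    replace (shifted 2 s 0) with (wt_permute (shifted 2 0 s)) by
      (unfold shifted, wt_permute; simpl; f_equal; ring).
    apply isomorphic_permute.
  + apply first_class_isomorphic.
  + apply second_class_isomorphic.
  + apply first_not_second.
  + apply exceptional_2_0.
  + apply exceptional_2_half.
- split; [|apply singular_0_0_1].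
  intros l1 l2 r1 r2 Hl Hr; apply isomorphic_delta_1; intros [-> ->];
    [apply Hl|apply Hr]; unfold shifted; f_equal; ring.
- split; [|split; [apply list_3half_orbit|apply singular_3half]].
  intros l1 l2 r1 r2 Hl Hr; apply isomorphic_delta_3half;
    try (unfold delta; simpl; ring); apply shifted_3half_generic; assumption.
Qed.
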